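(* Let $X\subset\mathbb{P}^N$ be a non-degenerate embedded toric variety. Let $\mathbf{r} = (r_1,\ldots,r_m) \in \mathbb{Z}_{\geq 1}^m$ and let $R = \sum_{k=1}^m (r_k-1)+1$. Then $$\dim\sigma_R(X)\ \le\ \dim \sigma_{\mathbf{r}}(X),\qquad \text{where } \sigma_{\mathbf{r}}(X):=\sigma_{r_1}(X)\star\cdots\star\sigma_{r_m}(X).$$
   Context: Homogeneous coordinates on $\mathbb{P}^N=\mathbb{P}^N_{\mathbb{C}}$ are fixed. An (embedded) toric variety is a positive-dimensional projective variety $X\subset\mathbb{P}^N$ that is the Zariski closure of the image of a monomial map $\varphi_A\colon(\mathbb{C}\smallsetminus\{0\})^{n+1}\to\mathbb{P}^N$, $\mathbf{x}\mapsto(\mathbf{x}^{\alpha_0}:\cdots:\mathbf{x}^{\alpha_N})$, where $A=(\alpha_0|\cdots|\alpha_N)\in\mathbb{Z}_{\ge0}^{(n+1)\times(N+1)}$ is a matrix whose columns all have the same coordinate sum $|\alpha_i|=|\alpha_j|$. It is non-degenerate if $\alpha_i\neq\alpha_j$ for all $i\neq j$. The $r$th secant variety $\sigma_r(X)$ is the Zariski closure of the union of the linear spans $\langle q_1,\ldots,q_r\rangle$ over $q_1,\ldots,q_r\in X$. The Hadamard product of points is the coordinate-wise product $(p_0:\cdots:p_N)\star(q_0:\cdots:q_N)=(p_0q_0:\cdots:p_Nq_N)$, defined whenever the right-hand side is not identically zero; the Hadamard product $Y\star Z$ of projective varieties is the Zariski closure of $\{p\star q : p\in Y,\ q\in Z,\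 p\star q\text{ exists}\}$, and products of several varieties are obtained by iterating. *)

(* Defs.v *)
(* mpoly is imported first, so that its names do not hide those of all_boot, and
   without its notations, which clash with those of boolp. *)
From mathcomp Require Import -(notations) mpoly.
From mathcomp Require Import all_boot all_order all_algebra generic_quotient.
From mathcomp Require Import boolp classical_sets reals constructive_ereal ereal.
From mathcomp.real_closed Require Import complex.

Set Implicit Arguments.
Unset Strict Implicit.
Unset Printing Implicit Defensive.

Import Order.TTheory GRing.Theory Num.Theory.
Local Open Scope ring_scope.
Local Open Scope classical_set_scope.
Local Open Scope quotient_scope.
Local Open Scope complex_scope.

Section ProjectiveSpace.
Variables (R : realType) (N : nat).
Local Notation C := (R[i]).

Definition nonzero_vec : Type := {x : 'rV[C]_N.+1 | x != 0}.

(* Two vectors are proportional when they have the same row space. *)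
Definition proportional (x y : nonzero_vec) : bool := (val x == val y)%MS.

Lemma proportional_refl : reflexive proportional.
Proof. by move=> x; rewrite /proportional submx_refl. Qed.

Lemma proportional_sym : symmetric proportional.
Proof. by move=> x y; rewrite /proportional andbC. Qed.

Lemma proportional_trans : transitive proportional.
Proof.
move=> y x z /andP[xy yx] /andP[yz zy].
by rewrite /proportional (submx_trans xy yz) (submx_trans zy yx).
Qed.

Canonical proportional_equiv :=
  EquivRel proportional proportional_refl proportional_sym proportional_trans.

Definition PN : Type := {eq_quot proportional_equiv}.

Definition coords (p : PN) : 'rV[C]_N.+1 := val (repr p).

(* The entries of x are homogeneous coordinates of p; false for x = 0. *)
Definition represents (x : 'rV[C]_N.+1) (p : PN) : bool := (x == coords p)%MS.

Lemma representsP (x : 'rV[C]_N.+1) (p : PN) :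
  reflect (exists2 c : C, c != 0 & x = c *: coords p) (represents x p).
Proof.
apply: (iffP idP) => [/andP[/sub_rVP[c xE] xs]|[c c0 ->]].
  exists c => //; apply: contraTneq xs => c0; rewrite xE c0 scale0r.
  exact: (contra (introT eqP \o @submx0null _ _ _ _ _) (valP (repr p))).
by rewrite /represents !(eqmx_scale _ c0) submx_refl.
Qed.

Lemma represents_pi (x : nonzero_vec) (p : PN) :
  represents (val x) p <-> p = \pi_PN x.
Proof.
rewrite /represents /coords; split=> [h|->].
  by rewrite -[p]reprK; apply/eqmodP; rewrite /= proportional_sym.
by case: piP => y /eqmodP.
Qed.

Definition vanishes_at (f : mpoly N.+1 C) (p : PN) : Prop :=
  meval (fun i => coords p 0 i) f = 0.

Definition homogeneous (f : mpoly N.+1 C) : Prop :=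
  exists d : nat, f \is ishomog1 d (@mdeg N.+1).

Lemma vanishes_at_represents (f : mpoly N.+1 C) (x : 'rV[C]_N.+1) (p : PN) :
  homogeneous f -> represents x p ->
  vanishes_at f p <-> meval (fun i => x 0 i) f = 0.
Proof.
move=> [d /dhomogP fd] /representsP[c c0 ->].
have -> : meval (fun i => (c *: coords p) 0 i) f
    = c ^+ d * meval (fun i => coords p 0 i) f.
  rewrite !mevalE mulr_sumr; apply: eq_big_seq => m mf.
  under eq_bigr => i _ do rewrite mxE exprMn.
  rewrite big_split /= mulrCA; congr (_ * _).
  have <- : mdeg m = d := fd m mf.
  by rewrite mdegE expr_sum.
rewrite /vanishes_at; split=> [->|/eqP]; first by rewrite mulr0.
by rewrite mulf_eq0 expf_eq0 (negbTE c0) andbF => /eqP.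
Qed.

Definition zariski_closed (Y : set PN) : Prop :=
  exists2 S : set (mpoly N.+1 C), S `<=` homogeneous &
    Y = [set p | forall f, S f -> vanishes_at f p].

Definition zariski_closure (Y : set PN) : set PN := smallest zariski_closed Y.

Definition irreducible (Y : set PN) : Prop :=
  Y !=set0 /\
  forall Z1 Z2 : set PN, zariski_closed Z1 -> zariski_closed Z2 ->
    Y `<=` Z1 `|` Z2 -> Y `<=` Z1 \/ Y `<=` Z2.

Definition irreducible_chain (Y : set PN) (d : nat) (Z : nat -> set PN) :=
  (forall i, (i <= d)%N ->
     [/\ zariski_closed (Z i), irreducible (Z i) & Z i `<=` Y]) /\
  (forall i, (i < d)%N -> Z i `<` Z i.+1).

(* Intended for closed Y, whose relatively closed subsets are the closed subsets
   of PN that it contains; krull_dim set0 = -oo. *)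
Definition krull_dim (Y : set PN) : \bar R :=
  ereal_sup [set d%:R%:E | d in [set d | exists Z, irreducible_chain Y d Z]].

Definition monomial_vec (n : nat) (A : 'M[nat]_(n.+1, N.+1)) (t : 'I_n.+1 -> C)
    : 'rV[C]_N.+1 :=
  \row_j \prod_i t i ^+ A i j.

Definition monomial_image (n : nat) (A : 'M[nat]_(n.+1, N.+1)) : set PN :=
  [set p | exists2 t : 'I_n.+1 -> C,
             forall i, t i != 0 & represents (monomial_vec A t) p].

Definition equal_column_sums (n : nat) (A : 'M[nat]_(n.+1, N.+1)) : Prop :=
  forall j k, (\sum_i A i j = \sum_i A i k)%N.

Definition distinct_columns (n : nat) (A : 'M[nat]_(n.+1, N.+1)) : Prop :=
  forall j k, j != k -> col j A <> col k A.

Definition nondegenerate_toric (X : set PN) : Prop :=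
  exists n (A : 'M[nat]_(n.+1, N.+1)),
    [/\ equal_column_sums A, distinct_columns A,
        X = zariski_closure (monomial_image A) & (0 < krull_dim X)%E].

Definition in_span (r : nat) (q : 'I_r -> PN) (p : PN) : bool :=
  (coords p <= \matrix_(i < r) coords (q i))%MS.

Definition secant (r : nat) (X : set PN) : set PN :=
  zariski_closure
    [set p | exists2 q : 'I_r -> PN, forall i, X (q i) & in_span q p].

Definition hadamard_vec (x y : 'rV[C]_N.+1) : 'rV[C]_N.+1 :=
  \row_i (x 0 i * y 0 i).

Definition hadamard (Y Z : set PN) : set PN :=
  zariski_closure
    [set s | exists p q, [/\ Y p, Z q &
               represents (hadamard_vec (coords p) (coords q)) s]].

(* Left-associated; the empty product is the unit point (1 : ... : 1). *)
Definition hadamard_prod (Ys : seq (set PN)) : set PN :=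
  if Ys is Y :: Ys' then foldl hadamard Y Ys'
  else [set p | represents (const_mx 1) p].

End ProjectiveSpace.

(* Main.v *)
Require Import Defs.
From mathcomp Require Import -(notations) mpoly.
From mathcomp Require Import all_boot all_order all_algebra generic_quotient.
From mathcomp Require Import boolp classical_sets reals constructive_ereal ereal.
From mathcomp.real_closed Require Import complex.
From mathcomp Require Import ring.

(** Write v(u) = lambda x^A for a block of parameters u = (lambda, x).  These
    vectors sweep out the cone over the toric variety X, so the R-th secant
    variety of X is contained in the closure of the image of
      G(u_0, u_1, ...) = v(u_0) + v(u_1) + ...      (R blocks).
    Distribute the blocks other than u_0 into m groups of r_k - 1 blocks.  The
    product of secant varieties contains the image of
      F(u_0, u_1, ...) = v(u_0) * prod_k (1 + sum_(l in group k) v(u_l)),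
    where * is the coordinatewise product: the vector 1 is v at the point 1,
    the translate of X by a point v(u_0) of the torus lies in X, and so v(u_0)
    can be absorbed into the first factor.  Both maps have the same parameters.
    To first order in the scales lambda_l of the blocks other than u_0 the
    product of the factors is 1 + sum_l v(u_l), so that F degenerates to
    v(u_0) * (1 + sum_l v(u_l)), which is G up to a change of parameters on the
    torus.  Hence the Jacobian of F has generic rank at least that of G: divide
    the columns of the Jacobian of F in the logarithmic coordinates of block l
    by lambda_l, and let the lambda_l vanish; the result is the Jacobian of G up
    to invertible diagonal factors ([rank_secant_map_limit]), and the rank can
    only grow at a general point ([rank_secant_map_le]).

    It remains to compare ranks of Jacobians with lengths of chains of
    irreducible closed subsets, by way of the Jacobian criterion in
    characteristic zero.

    A chain of length d in the closure of the image of G gives d + 1 polynomials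
    whose composites with G are algebraically independent: choose for each step
    an equation of the smaller set that does not vanish on the larger one
    ([chain_algindep]).  The Jacobian of these composites has rank d + 1 at some
    point, and therefore so has the Jacobian of G ([chain_jacobian_rank]).

    Conversely, if the Jacobian of F has rank greater than d at a point of the
    torus, choose d + 1 parameters, the overall scale among them, whose columns
    are independent there, freeze the others, and release the chosen ones one at
    a time.  The closures of the successive images are irreducible, and they
    increase strictly, because s + 1 linear combinations of the coordinates are
    algebraically independent on the image in s + 1 parameters, whereas any
    s + 1 polynomials in s parameters are dependent ([jacobian_rank_chain]). *)

Set Implicit Arguments.
Unset Strict Implicit.
Unset Printing Implicit Defensive.

Import Order.TTheory GRing.Theory Num.Theory.
Local Open Scope ring_scope.

Local Notation "{ 'mpoly' T [ n ] }" := (mpoly n T).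
Local Notation "p .@[ v ]" := (meval v p)
  (at level 1, left associativity, format "p .@[ v ]").
Local Notation "p ^`M ( i )" := (mderiv i p)
  (at level 8, format "p ^`M ( i )").
Local Notation "''X_' i" := (mpolyX _ (mnm1 i))
  (at level 8, i at level 2, format "''X_' i").
Local Notation "c %:MP" := (mpolyC _ c)
  (at level 1, left associativity, format "c %:MP").
Local Notation "p @_ m" := (mcoeff m p)
  (at level 3, m at level 2, format "p @_ m").
Local Notation subst h := (mmap (@mpolyC _ _) h).

Definition extend_last T s (h : 'I_s -> T) (x : T) (i : 'I_s.+1) : T :=
  if unlift ord_max i is Some j then h j else x.

Lemma extend_last_max T s (h : 'I_s -> T) x : extend_last h x ord_max = x.
Proof. by rewrite /extend_last unlift_none. Qed.

Lemma extend_last_lift T s (h : 'I_s -> T) x j :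
  extend_last h x (lift ord_max j) = h j.
Proof. by rewrite /extend_last liftK. Qed.

Lemma extend_last_widen T s (h : 'I_s -> T) x (j : 'I_s) :
  extend_last h x (widen_ord (leqnSn s) j) = h j.
Proof.
rewrite -(extend_last_lift h x); congr extend_last.
by apply: val_inj; rewrite /= /bump leqNgt ltn_ord.
Qed.

(** * Finite types and linear algebra *)

Lemma card_tag_fibre (I : finType) (J : I -> finType) (k : I) :
  #|[pred s : {k : I & J k} | tag s == k]| = #|J k|.
Proof.
rewrite -(card_image (f := fun i : J k => Tagged J i)) => [|i i' /eqP]; last first.
  by rewrite -tag_eqE /tag_eq eqxx tagged_asE => /eqP.
apply: eq_card => -[k' i].
apply/idP/fintype.imageP => [|[i' _ ->]]; rewrite inE //=.
by move=> /eqP kk'; case: k / kk'; exists i.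
Qed.

Section LinearAlgebra.
Variable K : fieldType.

Lemma rank_mul_diag r c (D : 'rV[K]_c) (M : 'M[K]_(r, c)) :
  (forall k, D 0 k != 0) -> \rank (M *m diag_mx D) = \rank M.
Proof.
move=> D0; rewrite mxrankMfree // row_free_unit unitmxE det_diag unitfE.
exact/prodf_neq0.
Qed.

(** Steinitz exchange, keeping a prescribed first row: in the application that
    row belongs to the scale of the parametrization. *)
Lemma exists_free_rows q p (M : 'M[K]_(q, p)) k0 s :
  row k0 M != 0 -> (s < \rank M)%N ->
  exists k : 'I_s.+1 -> 'I_q, k ord0 = k0 /\ row_free (rowsub k M).
Proof.
move=> k0M; elim: s => [|s IHs] sM.
  exists (fun=> k0); split=> //; rewrite -row_leq_rank lt0n mxrank_eq0.
  apply: contra_neq k0M => /matrixP M0; apply/rowP => j.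
  by move: (M0 ord0 j); rewrite !mxE.
have [k [kk0 kfree]] := IHs (ltnW sM).
have [k' k'M] : exists k', ~~ (row k' M <= rowsub k M)%MS.
  apply/existsP; rewrite -negb_forall; apply: contraL sM => /forallP Mk.
  rewrite -leqNgt -(eqP kfree) mxrankS //; exact/row_subP.
exists (extend_last k k'); split.
  rewrite -kk0 -(extend_last_widen k k'); congr extend_last; exact: val_inj.
apply: inj_row_free => u /rowP uM.
have uE : u 0 ord_max *: row k' M +
    (\row_a u 0 (lift ord_max a)) *m rowsub k M = 0.
  apply/rowP => j; rewrite -[RHS](uM j) [RHS]mxE big_ord_recr /= addrC.
  rewrite !mxE extend_last_max.
  congr (_ + _); apply: eq_bigr => a _; rewrite !mxE extend_last_widen.
  by congr (u _ _ * _); apply: val_inj; rewrite /= /bump leqNgt ltn_ord.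
have um : u 0 ord_max = 0.
  apply: contraNeq k'M => um; rewrite -(eqmx_scale _ um).
  by move/eqP: uE; rewrite addr_eq0 => /eqP ->; rewrite eqmx_opp submxMl.
move: uE; rewrite um scale0r add0r => /eqP.
rewrite -(mul0mx _ (rowsub k M)) (inj_eq (row_free_inj kfree)) => /eqP/rowP ul.
apply/rowP => a; rewrite mxE; case: (unliftP ord_max a) => [b ->|->] //.
by move: (ul b); rewrite !mxE.
Qed.

End LinearAlgebra.

(** * Substitution and derivatives of multivariate polynomials *)

Section PolynomialMaps.
Variable K : numFieldType.

(** Polynomials are generated as a ring by constants and variables, so identities
    between ring morphisms and derivations need only be checked there. *)
Lemma mpoly_ring_ind n (P : {mpoly K[n]} -> Prop) :
  (forall c, P c%:MP) -> (forall i, P 'X_i) ->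
  (forall p q, P p -> P q -> P (p + q)) ->
  (forall p q, P p -> P q -> P (p * q)) -> forall p, P p.
Proof.
move=> PC PX PD PM; elim/mpolyind => [|c m p _ _ Pp].
  by rewrite -(mpolyC0 n K).
apply: (PD) => //; rewrite -mul_mpolyC; apply: (PM) => //.
rewrite mpolyXE_id; apply: (big_ind P) => [||i _]; [exact: (PC 1)|exact: PM|].
by elim: (m i) => [|k IHk]; [exact: (PC 1) | rewrite exprS; apply: (PM)].
Qed.

Lemma mderiv_var n i k : ('X_i : {mpoly K[n]})^`M(k) = (i == k)%:R.
Proof.
rewrite mderivX mnm1E; case: eqVneq => [->|_]; last by rewrite scale0r.
rewrite scale1r -(mpolyX0 n K); congr mpolyX; apply/mnmP => j.
by rewrite mnmBE mnm0E subnn.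
Qed.

Lemma meval_subst n s (h : 'I_s -> {mpoly K[n]}) (g : {mpoly K[s]}) v :
  (subst h g).@[v] = g.@[fun l => (h l).@[v]].
Proof.
rewrite /mmap raddf_sum mevalE; apply: eq_bigr => m _ /=.
by rewrite mevalM mevalC rmorph_prod; under eq_bigr do rewrite rmorphXn.
Qed.

Lemma mderiv_subst n s (h : 'I_s -> {mpoly K[n]}) (g : {mpoly K[s]}) k :
  (subst h g)^`M(k) = \sum_l subst h g^`M(l) * (h l)^`M(k).
Proof.
elim/mpoly_ring_ind: g => [c|i|p q IHp IHq|p q IHp IHq].
- by rewrite mmapC mderivC big1 // => l _; rewrite mderivC raddf0 mul0r.
- rewrite mmapX mmap1U (bigD1 i) //= big1 => [|l li]; rewrite mderiv_var.
    by rewrite eqxx rmorph1 mul1r addr0.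
  by rewrite eq_sym (negbTE li) rmorph0 mul0r.
- rewrite mmapD mderivD IHp IHq -big_split; apply: eq_bigr => l _.
  by rewrite mderivD mmapD mulrDl.
- rewrite rmorphM mderivM IHp IHq mulr_suml mulr_sumr -big_split /=.
  apply: eq_bigr => l _.
  by rewrite mderivM mmapD !rmorphM mulrDl /= mulrAC mulrA.
Qed.

Lemma subst_subst n s t (h : 'I_s -> {mpoly K[n]}) (f : 'I_t -> {mpoly K[s]}) g :
  subst h (subst f g) = subst (fun i => subst h (f i)) g.
Proof.
rewrite [subst f g]/mmap raddf_sum [RHS]/mmap; apply: eq_bigr => m _.
rewrite /= rmorphM /= mmapC /mmap1 rmorph_prod; congr (_ * _).
by apply: eq_bigr => i _; rewrite rmorphXn.
Qed.

(** Relates polynomials in n + 1 variables to univariate polynomials with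
    coefficients in n variables; inductions on the number of variables and the
    notion of a root of multiplicity k both go through it. *)
Lemma mmap_muni n (S : comNzRingType) (f : {rmorphism K -> S})
    (h : 'I_n.+1 -> S) (g : {mpoly K[n.+1]}) :
  mmap f h g =
  (map_poly (mmap f (fun i => h (widen_ord (leqnSn n) i))) (muni g)).[h ord_max].
Proof.
set phi : 'I_n -> S := fun i => _.
pose ev : {rmorphism {mpoly K[n]} -> S} := mmap f phi.
rewrite muniE -[mmap f phi]/(ev : _ -> _) raddf_sum horner_sum [LHS]/mmap.
apply: eq_bigr => m _; rewrite /= map_polyZ map_polyXn.
rewrite hornerZ hornerXn /ev /= mmapZ mmapX.
rewrite /mmap1 big_ord_recr /= -mulrA; congr (_ * (_ * _)).
by apply: eq_bigr => i _; rewrite mnmE.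
Qed.

Lemma muni_eq0 n (g : {mpoly K[n.+1]}) : muni g = 0 -> g = 0.
Proof.
move=> g0; rewrite -[g]comp_mpoly_id /comp_mpoly.
by rewrite mmap_muni g0 raddf0 horner0.
Qed.

(** One of the natural numbers up to the degree of X p is not a root of X p. *)
Lemma exists_nonroot (p : {poly K}) : p != 0 -> exists2 t, t != 0 & p.[t] != 0.
Proof.
move=> p0; have q0 : p * 'X != 0 by rewrite mulf_neq0 // polyX_eq0.
pose rs := [seq i%:R : K | i <- iota 0 (size (p * 'X))].
have : ~~ all (root (p * 'X)) rs.
  apply/negP => /(max_poly_roots q0); rewrite size_map size_iota ltnn => abs.
  suff /abs : uniq rs by [].
  by rewrite map_inj_uniq ?iota_uniq // => i j /eqP; rewrite eqr_nat => /eqP.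
case/allPn => t _; rewrite rootE hornerM hornerX mulf_eq0 negb_or.
by case/andP; exists t.
Qed.

Lemma polynomial_eq0 (p : {poly K}) : (forall c, c != 0 -> p.[c] = 0) -> p = 0.
Proof.
move=> p0; apply/eqP; case: eqVneq => // /exists_nonroot[t t0].
by rewrite p0 // eqxx.
Qed.

(** The torus is Zariski dense in affine space.  By induction, the leading
    coefficient in the last variable survives at some torus point; then choose a
    nonzero non-root. *)
Lemma exists_nonvanishing n (f : {mpoly K[n]}) : f != 0 ->
  exists2 v : 'I_n -> K, forall i, v i != 0 & f.@[v] != 0.
Proof.
elim: n f => [|n IHn] f f0.
  exists (fun=> 1) => [i|]; first exact: oner_neq0.
  by move: f0; rewrite [f]nvar0_mpolyC mpolyC_eq0 mevalC.
have mf0 : lead_coef (muni f) != 0.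
  by rewrite lead_coef_eq0; apply: contra_neq f0; exact: muni_eq0.
have [v vn0 lv] := IHn _ mf0.
have [|t t0 ft] := @exists_nonroot (map_poly (meval v) (muni f)).
  apply: contra_neq lv => Pv; move/(congr1 (coefp (size (muni f)).-1)) : Pv.
  by rewrite /= coef_map coef0.
exists (extend_last v t) => [i|].
  by rewrite /extend_last; case: unliftP.
rewrite /meval mmap_muni extend_last_max.
congr (_ != 0): ft; congr _.[_]; apply: eq_map_poly => g.
by apply: meval_eq => i; rewrite extend_last_widen.
Qed.

Lemma meval_map_mpolyC n a b (C : 'M[K]_(a, b)) (v : 'I_n -> K) :
  map_mx (meval v) (map_mx (@mpolyC n K) C) = C.
Proof. by apply/matrixP => i j; rewrite !mxE mevalC. Qed.

(** If C is a right inverse of A at v, then det (A C) takes the value 1 at v, so it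
    is a nonzero polynomial: A has independent rows over the ring of
    polynomials. *)
Lemma row_free_meval n s q (A : 'M[{mpoly K[n]}]_(s, q)) v (w : 'rV_s) :
  row_free (map_mx (meval v) A) -> w *m A = 0 -> w = 0.
Proof.
move=> /row_freeP[C AC] wA.
pose D := A *m map_mx (@mpolyC n K) C.
have D0 : \det D != 0.
  apply/eqP => /(congr1 (meval v)); rewrite -det_map_mx map_mxM.
  by rewrite meval_map_mpolyC AC det1 meval0 => /eqP; rewrite oner_eq0.
have : \det D *: w = 0.
  by rewrite -mul_mx_scalar -mul_mx_adj mulmxA mulmxA wA !mul0mx.
move/rowP => wD; apply/rowP => i; move: (wD i); rewrite !mxE => /eqP.
by rewrite mulf_eq0 (negbTE D0) => /eqP.
Qed.

(** Lower semicontinuity of the rank: a minor witnessing the rank at v is a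
    nonzero polynomial, which stays nonzero at a general point of the torus; the
    polynomial d carries further open conditions on that point. *)
Lemma rank_meval_generic n a b (A : 'M[{mpoly K[n]}]_(a, b)) v
    (d : {mpoly K[n]}) :
  d != 0 -> exists v', [/\ forall i, v' i != 0, d.@[v'] != 0 &
    (\rank (map_mx (meval v) A) <= \rank (map_mx (meval v') A))%N].
Proof.
move=> d0; set Av := map_mx (meval v) A; set r := \rank Av.
have /row_fullP[L LA] := col_base_full Av.
have /row_freeP[C AC] := row_base_free Av.
pose D := map_mx (@mpolyC n K) L *m A *m map_mx (@mpolyC n K) C.
have DE u : map_mx (meval u) D = L *m map_mx (meval u) A *m C.
  by rewrite !map_mxM !meval_map_mpolyC.
have Dd0 : \det D * d != 0.
  rewrite mulf_neq0 //; apply/eqP => /(congr1 (meval v)).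
  rewrite -det_map_mx DE -/Av -[X in L *m X](mulmx_base Av) mulmxA LA.
  by rewrite mul1mx AC det1 meval0 => /eqP; rewrite oner_eq0.
have [v' v'0] := exists_nonvanishing Dd0.
rewrite mevalM mulf_eq0 negb_or => /andP[Dv' dv'].
exists v'; split=> //.
have : map_mx (meval v') D \in unitmx by rewrite unitmxE det_map_mx unitfE.
rewrite -row_full_unit /row_full DE => /eqP rD; rewrite -[leqLHS]rD.
exact: leq_trans (mxrankM_maxl _ _) (mxrankM_maxr _ _).
Qed.

(** * The Jacobian criterion *)

Definition algindep n s (h : 'I_s -> {mpoly K[n]}) : Prop :=
  forall g : {mpoly K[s]}, subst h g = 0 -> g = 0.

Definition jacobian n s (h : 'I_s -> {mpoly K[n]}) : 'M[{mpoly K[n]}]_(s, n) :=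
  \matrix_(l, k) (h l)^`M(k).

Lemma msize_mderiv n (g : {mpoly K[n]}) l b :
  (mmeasure (@mdeg n) g <= b.+1)%N -> (mmeasure (@mdeg n) g^`M(l) <= b)%N.
Proof.
move=> gb; rewrite mmeasureE; apply/bigmax_leqP_seq => m.
rewrite mcoeff_msupp mcoeff_deriv => gm _.
have : mnm_add m (mnm1 l) \in msupp g.
  by rewrite mcoeff_msupp; apply: contra_neq gm => ->; rewrite mul0rn.
by move/msize_mdeg_lt; rewrite mdegD mdeg1 addn1 => /leq_trans/(_ gb).
Qed.

Lemma mderiv_eq0 n (g : {mpoly K[n]}) :
  (forall l, g^`M(l) = 0) -> g = (g@_mnm0)%:MP.
Proof.
move=> dg; apply/mpolyP => m; rewrite mcoeffC; have [->|m0] := eqVneq m mnm0.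
  by rewrite mulr1.
rewrite mulr0; have [l ml] : exists l, m l != 0%N.
  apply/existsP; rewrite -negb_forall; apply: contra m0 => /forallP m0.
  by apply/eqP/mnmP => i; rewrite mnm0E; apply/eqP; have := m0 i.
have := mcoeff_deriv l (mnm_sub m (mnm1 l)) g; rewrite dg mcoeff0 submK.
  by move/esym/eqP; rewrite mulrn_eq0 => /eqP.
by rewrite lep1mP.
Qed.

(** If g is a relation between the h_l, then the chain rule says that the vector of
    the (d_l g)(h) annihilates the Jacobian, so the d_l g are again relations, of
    smaller degree; by induction they vanish, and g is constant. *)
Lemma row_free_jacobian_algindep n s (h : 'I_s -> {mpoly K[n]}) v :
  row_free (map_mx (meval v) (jacobian h)) -> algindep h.
Proof.
move=> free g; move: {2}(mmeasure _ g) (leqnn (mmeasure (@mdeg s) g)) => b.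
elim: b g => [|b IHb] g gb hg0.
  by apply/eqP; rewrite -(mmeasure_poly_eq0 (@mdeg s)) -leqn0.
have w0 : \row_l subst h g^`M(l) = 0.
  apply: row_free_meval free _; apply/rowP => k; rewrite !mxE.
  transitivity ((subst h g)^`M(k)); last by rewrite hg0 mderiv0.
  by rewrite mderiv_subst; apply: eq_bigr => l _; rewrite !mxE.
have gC : g = (g@_mnm0)%:MP.
  apply: mderiv_eq0 => l; apply: IHb; first exact: msize_mderiv.
  by move/rowP/(_ l): w0; rewrite !mxE.
move: hg0; rewrite gC mmapC => /eqP; rewrite mpolyC_eq0 => /eqP ->.
by rewrite mpolyC0.
Qed.

Lemma msize_exp n (p : {mpoly K[n]}) k :
  (mmeasure (@mdeg n) (p ^+ k) <= (k * (mmeasure (@mdeg n) p).+1).+1)%N.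
Proof.
elim: k => [|k IHk]; first by rewrite expr0 -(mpolyC1 n K) mmeasureC oner_eq0.
rewrite exprS (leq_trans (msizeM_le _ _)) // mulSn !addSn ltnS.
by rewrite -addnS leq_add2l.
Qed.

Lemma msize_prod n s (q : 'I_s -> {mpoly K[n]}) b :
  (forall l, mmeasure (@mdeg n) (q l) <= b)%N ->
  (mmeasure (@mdeg n) (\prod_l q l) <= (s * b.+1).+1)%N.
Proof.
elim: s q => [|s IHs] q qb.
  by rewrite big_ord0 -(mpolyC1 n K) mmeasureC oner_eq0.
rewrite big_ord_recl (leq_trans (msizeM_le _ _)) // mulSn !addSn ltnS.
by rewrite -addnS leq_add // IHs.
Qed.

(** The monomials with exponents below D in each variable, indexed by a finite
    type whose cardinality is visibly D ^ n. *)
Definition box_monomial n D (a : {ffun 'I_n -> 'I_D}) : multinom n :=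
  Multinom [tuple (a i : nat) | i < n].

Lemma box_monomial_inj n D : injective (@box_monomial n D).
Proof.
move=> a b /mnmP eab; apply/ffunP => i; apply/val_inj.
by move: (eab i); rewrite !mnmE.
Qed.

(** Counting: the D ^ s products of powers of the h_l with exponents below D have
    degree below c D for a constant c, hence lie in a space of dimension
    (c D) ^ n.  For D > c ^ n and s > n there are more products than dimensions,
    and a linear relation between them is an algebraic relation between the
    h_l. *)
Lemma exists_algebraic_relation n s (h : 'I_s -> {mpoly K[n]}) :
  (n < s)%N -> exists2 g : {mpoly K[s]}, g != 0 & subst h g = 0.
Proof.
move=> ns; pose d := \max_l mmeasure (@mdeg n) (h l).
(* D = c ^ n + 1 is the least D for which (c D) ^ n < D ^ n.+1. *)
pose c := (s * d.+3).+1; pose D := (c ^ n).+1; pose E := (c * D)%N.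
pose hm a := \prod_l h l ^+ (@box_monomial s D a l).
have hmE a : (mmeasure (@mdeg n) (hm a) <= E)%N.
  apply: leq_trans (_ : (s * (D * d.+1).+2).+1 <= _)%N.
    apply: msize_prod => l; apply: leq_trans (msize_exp _ _) _.
    rewrite ltnS leq_mul //; first by rewrite mnmE ltnW.
    by rewrite ltnS; apply: (leq_bigmax l).
  rewrite /E /c mulSn -[X in (X <= _)%N]add1n leq_add // -mulnA leq_mul2l.
  rewrite [leqRHS]mulnC 2![in leqRHS]mulnS addnA -(add2n (D * d.+1)) leq_add2r.
  by rewrite /D addSn addnS orbT.
pose M : 'M[K]_(#|{ffun 'I_s -> 'I_D}|, #|{ffun 'I_n -> 'I_E}|) :=
  \matrix_(a, b) (hm (enum_val a))@_(box_monomial (enum_val b)).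
have : kermx M != 0.
  rewrite -mxrank_eq0 mxrank_ker -lt0n subn_gt0.
  rewrite (leq_ltn_trans (rank_leq_col _)) // !card_ffun !card_ord.
  rewrite expnMn (@leq_trans (D ^ n.+1)) //.
    by rewrite expnS ltn_pmul2r ?expn_gt0.
  by rewrite leq_pexp2l.
case/rowV0Pn => u /sub_kermxP uM u0.
exists (\sum_a u 0 a *: mpolyX K (box_monomial (enum_val a))).
  apply: contra_neq u0 => g0; apply/rowP => a; rewrite mxE.
  move/(congr1 (mcoeff (box_monomial (enum_val a)))): g0.
  rewrite raddf_sum mcoeff0 (bigD1 a) //= big1 => [|b ba].
    by rewrite mcoeffZ mcoeffX eqxx mulr1 addr0.
  rewrite mcoeffZ mcoeffX; case: eqP => [/box_monomial_inj/enum_val_inj ab|].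
    by rewrite ab eqxx in ba.
  by rewrite mulr0.
rewrite raddf_sum; under eq_bigr => a _ do
  rewrite /= mmapZ mmapX mul_mpolyC -[mmap1 _ _]/(hm (enum_val a)).
apply/mpolyP => m; rewrite mcoeff0 raddf_sum /=.
have [/forallP mE|] := boolP [forall i, (m i < E)%N].
  pose b : {ffun 'I_n -> 'I_E} := [ffun i => Ordinal (mE i)].
  move/rowP/(_ (enum_rank b)): uM; rewrite !mxE => uMb.
  rewrite -[RHS]uMb; apply: eq_bigr => a _.
  rewrite !mxE enum_rankK mcoeffZ; congr (_ * mcoeff _ _).
  by apply/mnmP => i; rewrite mnmE ffunE.
case/forallPn => i; rewrite -leqNgt => Emi.
rewrite big1 // => a _; rewrite mcoeffZ memN_msupp_eq0 ?mulr0 //.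
apply: msize_mdeg_ge; apply: leq_trans (hmE _) _; apply: leq_trans Emi _.
by rewrite mdegE (bigD1 i) //= leq_addr.
Qed.

Lemma algindep_size n s (h : 'I_s -> {mpoly K[n]}) : algindep h -> (s <= n)%N.
Proof.
move=> hI; rewrite leqNgt; apply/negP => /(exists_algebraic_relation h).
by case=> g /eqP g0 /hI.
Qed.

(** The chain rule for P(h, x): only the factor of the derivative of x matters, and
    the coefficients W l are the same for all the directions k. *)
Lemma mderiv_horner_subst n s (h : 'I_s -> {mpoly K[n]}) x
    (P : {poly {mpoly K[s]}}) :
  exists W : 'I_s -> {mpoly K[n]}, forall k,
    ((map_poly (subst h) P).[x])^`M(k) =
    \sum_l W l * (h l)^`M(k) + (map_poly (subst h) P^`()).[x] * x^`M(k).
Proof.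
elim/poly_ind: P => [|P c [W IHP]].
  exists (fun=> 0) => k; rewrite deriv0 !raddf0 !horner0 mderiv0 mul0r addr0.
  by rewrite big1 // => l _; rewrite mul0r.
exists (fun l => W l * x + subst h c^`M(l)) => k.
rewrite derivD derivM derivX derivC mulr1 addr0 !rmorphD !rmorphM /=.
rewrite !map_polyX !map_polyC !hornerE /= mderivD mderivM IHP mderiv_subst.
under [in RHS]eq_bigr => l _ do rewrite mulrDl mulrAC.
rewrite big_split /= -mulr_suml mulrDl !mulrDl.
by rewrite (mulrAC _ x) -!addrA; congr (_ + _); rewrite addrA addrC.
Qed.

(** As long as the derivative of P in the last variable also gives a relation, it
    can replace P and has smaller degree.  It cannot vanish identically: in
    characteristic zero P would then be a relation between the h_l alone. *)
Lemma exists_separable_relation n s (h : 'I_s -> {mpoly K[n]}) x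
    (P : {poly {mpoly K[s]}}) :
  algindep h -> P != 0 -> (map_poly (subst h) P).[x] = 0 ->
  exists2 Q : {poly {mpoly K[s]}}, (map_poly (subst h) Q).[x] = 0 &
    (map_poly (subst h) Q^`()).[x] != 0.
Proof.
move=> hI; move: {2}(size P) (leqnn (size P)) => b.
elim: b P => [|b IHb] P Pb P0 hP0.
  by rewrite -size_poly_eq0 -leqn0 Pb in P0.
have [dP0|] := eqVneq (map_poly (subst h) P^`()).[x] 0; last by exists P.
have [dP|dP] := eqVneq P^`() 0; last first.
  apply: IHb dP dP0; rewrite -ltnS; apply: leq_trans Pb.
  by apply: lt_size_deriv.
have PC : P = (P`_0)%:P.
  apply/polyP => -[|i]; rewrite coefC //=.
  move/polyP/(_ i): dP; rewrite coef_deriv coef0 -scaler_nat => /eqP.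
  by rewrite scaler_eq0 pnatr_eq0 /= => /eqP.
move: hP0 P0; rewrite PC map_polyC hornerC /= => /hI ->.
by rewrite eqxx.
Qed.

Lemma row_free_jacobian_sub n s (h : 'I_s -> {mpoly K[n]}) x v :
  row_free (map_mx (meval v) (jacobian (extend_last h x))) ->
  row_free (map_mx (meval v) (jacobian h)).
Proof.
set J' := map_mx _ _ => free; set J := map_mx _ _.
have JJ' : J = rowsub (lift ord_max) J'.
  by apply/matrixP => l k; rewrite !mxE extend_last_lift.
apply: inj_row_free => u; rewrite JJ' rowsubE mulmxA => /eqP.
rewrite -(mul0mx _ J') (inj_eq (row_free_inj free)) => /eqP/rowP uE.
apply/rowP => i; have := uE (lift ord_max i).
rewrite !mxE (bigD1 i) //= !mxE eqxx mulr1 big1 ?addr0 // => j ji.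
by rewrite !mxE (inj_eq lift_inj) (negbTE ji) mulr0.
Qed.

(** Every variable X_i satisfies a separable relation over the h_l.  Its
    differential expresses dX_i, with a nonzero factor, as a combination of the
    dh_l, so the dh_l span all the differentials. *)
Lemma algebraic_jacobian_rank n s (h : 'I_s -> {mpoly K[n]}) :
  algindep h ->
  (forall i : 'I_n, ~ algindep (extend_last h 'X_i)) ->
  exists v, \rank (map_mx (meval v) (jacobian h)) = n.
Proof.
move=> hI hX.
have relP (i : 'I_n) : exists W : ('I_s -> {mpoly K[n]}) * {mpoly K[n]},
    [/\ W.2 != 0 & forall k,
    \sum_l W.1 l * (h l)^`M(k) + W.2 * ('X_i : {mpoly K[n]})^`M(k) = 0].
  have /existsNP[g /not_implyP[hg /eqP g0]] := hX i.
  have mg0 : muni g != 0 by apply: contra_neq g0; exact: muni_eq0.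
  have [|Q Q0 dQ0] := exists_separable_relation hI mg0 (x := 'X_i).
    rewrite mmap_muni extend_last_max in hg; rewrite -[RHS]hg.
    congr _.[_]; apply: eq_map_poly => p; congr mmap.
    by apply/funext => j; rewrite extend_last_widen.
  have [W WE] := mderiv_horner_subst h 'X_i Q.
  exists (W, (map_poly (subst h) Q^`()).['X_i]); split; first exact: dQ0.
  by move=> k; rewrite -WE Q0 mderiv0.
have [W WP] := choice relP.
pose d := \prod_i (W i).2.
have [|v _ dv] := @exists_nonvanishing n d.
  by apply/prodf_neq0 => i _; have [] := WP i.
exists v; set J := map_mx _ _.
pose B : 'M[K]_(n, s) := \matrix_(i, l) ((W i).1 l).@[v].
have BJ : B *m J = - diag_mx (\row_i ((W i).2).@[v]).
  apply/matrixP => i k; have [_ /(_ k)] := WP i.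
  move/(congr1 (meval v)); rewrite mevalD meval0 mevalM rmorph_sum /=.
  rewrite mderiv_var rmorph_nat !mxE => /eqP; rewrite addr_eq0 => /eqP E.
  transitivity (\sum_l ((W i).1 l * (h l)^`M(k)).@[v]).
    by apply: eq_bigr => l _; rewrite !mxE mevalM.
  by rewrite E mulr_natr.
apply/eqP; rewrite eqn_leq rank_leq_col /=.
suff BJr : \rank (B *m J) = n by rewrite -[leqLHS]BJr mxrankM_maxr.
rewrite BJ eqmx_opp; apply/mxrank_unit; rewrite unitmxE det_diag unitfE.
under eq_bigr do rewrite mxE.
by rewrite -rmorph_prod.
Qed.

(** Adjoin variables to the family as long as it stays independent; a family of s
    independent polynomials has s <= n, so this stops, at a family over which all
    variables are algebraic.  By then the rank n of the Jacobian forces s = n and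
    independent rows. *)
Lemma exists_row_free_jacobian n s (h : 'I_s -> {mpoly K[n]}) :
  algindep h -> exists v, row_free (map_mx (meval v) (jacobian h)).
Proof.
have algebraic_case s' (h' : 'I_s' -> {mpoly K[n]}) : algindep h' ->
    ~ (exists i : 'I_n, algindep (extend_last h' 'X_i)) ->
    exists v, row_free (map_mx (meval v) (jacobian h')).
  move=> hI hX.
  have [|v rv] := algebraic_jacobian_rank hI.
    by move=> i hi; apply: hX; exists i.
  by exists v; rewrite -row_leq_rank rv (algindep_size hI).
move: {2}(n - s)%N (leqnn (n - s)%N) => b.
elim: b s h => [|b IHb] s h sb hI.
  apply: algebraic_case => // -[i /algindep_size].
  by rewrite ltnNge -subn_eq0 -leqn0 sb.
have [[i hXI]|] := pselect (exists i : 'I_n, algindep (extend_last h 'X_i)).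
  have [|v rv] := IHb _ _ _ hXI; first by rewrite subnS -subn1 leq_subLR add1n.
  by exists v; exact: row_free_jacobian_sub rv.
exact: algebraic_case.
Qed.

(** * Homogeneous components and cones over projective sets *)

(** The restriction of f to the line through 0 and v, as a polynomial in the
    parameter of the line.  Its coefficients are the values at v of the homogeneous
    components of f, so it translates statements about arbitrary polynomials on a
    cone into statements about homogeneous ones. *)
Definition ray_poly n (f : {mpoly K[n]}) (v : 'I_n -> K) : {poly K} :=
  \poly_(d < mmeasure (@mdeg n) f) (pihomog (@mdeg n) d f).@[v].

Lemma meval_homog n (f : {mpoly K[n]}) d (v : 'I_n -> K) c :
  f \is ishomog1 d (@mdeg n) -> f.@[fun i => c * v i] = c ^+ d * f.@[v].
Proof.
move=> /dhomogP fd; rewrite !mevalE mulr_sumr; apply: eq_big_seq => m mf.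
under eq_bigr => i _ do rewrite exprMn.
rewrite big_split /= mulrCA; congr (_ * _).
by have <- : mdeg m = d := fd m mf; rewrite mdegE expr_sum.
Qed.

Lemma horner_ray_poly n (f : {mpoly K[n]}) v c :
  (ray_poly f v).[c] = f.@[fun i => c * v i].
Proof.
rewrite [in RHS](pihomog_partitionE (leqnn (mmeasure (@mdeg n) f))).
rewrite horner_poly rmorph_sum; apply: eq_bigr => d _ /=.
by rewrite (meval_homog _ _ (pihomogP _ _ _)) mulrC.
Qed.

Lemma coef_ray_poly n (f : {mpoly K[n]}) v d :
  (ray_poly f v)`_d = (pihomog (@mdeg n) d f).@[v].
Proof.
rewrite coef_poly; case: leqP => // fd.
rewrite pihomogE big_seq_cond big1 ?meval0 // => m /andP[/msize_mdeg_lt mf /eqP md].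
by move: (leq_trans mf fd); rewrite md ltnn.
Qed.

Lemma jacobian_subst n s t (h : 'I_s -> {mpoly K[n]}) (f : 'I_t -> {mpoly K[s]}) v :
  map_mx (meval v) (jacobian (fun i => subst h (f i))) =
  map_mx (meval (fun l => (h l).@[v])) (jacobian f) *m
    map_mx (meval v) (jacobian h).
Proof.
apply/matrixP => i k; rewrite !mxE mderiv_subst rmorph_sum; apply: eq_bigr => l _.
by rewrite !mxE /= mevalM meval_subst.
Qed.

End PolynomialMaps.

Section Cones.
Variables (R : realType) (N : nat).
Local Notation C := (R[i]).
Local Notation PN := (PN R N).
Implicit Types (Y Z : set PN) (V : set 'rV[C]_N.+1) (f g : {mpoly C[N.+1]}).

Definition vanishes_on f V : Prop := forall x, V x -> f.@[fun i => x 0 i] = 0.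

Definition cone Y : set 'rV[C]_N.+1 := [set x | exists2 p, Y p & represents x p].

Lemma cone_coords Y p : Y p -> cone Y (coords p).
Proof.
by exists p => //; apply/representsP; exists 1; rewrite ?oner_neq0 ?scale1r.
Qed.

Lemma cone_scale Y p c : Y p -> c != 0 -> cone Y (c *: coords p).
Proof. by move=> Yp c0; exists p => //; apply/representsP; exists c. Qed.

Lemma meval_scale f (x : 'rV[C]_N.+1) c :
  f.@[fun i => (c *: x) 0 i] = f.@[fun i => c * x 0 i].
Proof. by apply: meval_eq => i; rewrite mxE. Qed.

Lemma vanishes_on_point f p :
  (forall x, represents x p -> f.@[fun i => x 0 i] = 0) <->
  ray_poly f (fun i => coords p 0 i) = 0.
Proof.
split=> [fp|fp x /representsP[c _ ->]].
  apply: polynomial_eq0 => c c0; rewrite horner_ray_poly -meval_scale.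
  by apply: fp; apply/representsP; exists c.
by rewrite meval_scale -horner_ray_poly fp horner0.
Qed.

Definition prime_vanishing V : Prop := forall f g,
  vanishes_on (f * g) V -> vanishes_on f V \/ vanishes_on g V.

Lemma prime_vanishing_cancel V f g k : prime_vanishing V -> ~ vanishes_on g V ->
  vanishes_on (f * g ^+ k) V -> vanishes_on f V.
Proof.
move=> Vp gV; elim: k => [|k IHk]; first by rewrite expr0 mulr1.
by rewrite exprSr mulrA => /Vp[].
Qed.

Local Open Scope classical_set_scope.

(** Vanishing of f on the whole line of p amounts to the vanishing at p of all the
    homogeneous components of f. *)
Lemma zariski_closed_vanishing f :
  zariski_closed [set p | forall x, represents x p -> f.@[fun i => x 0 i] = 0].
Proof.
exists [set pihomog (@mdeg N.+1) d f | d in [set: nat]].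
  by move=> _ [d _ <-]; exists d; exact: pihomogP.
apply/seteqP; split=> p /=.
  move=> /vanishes_on_point fp _ [d _ <-].
  by rewrite /vanishes_at -coef_ray_poly fp coef0.
move=> fp; apply/vanishes_on_point/polyP => d; rewrite coef0 coef_ray_poly.
by apply: fp; exists d.
Qed.

Lemma sub_zariski_closure Y : Y `<=` zariski_closure Y.
Proof. exact: sub_gen_smallest. Qed.

Lemma zariski_closure_min Y Z :
  zariski_closed Z -> Y `<=` Z -> zariski_closure Y `<=` Z.
Proof. by move=> Zc YZ; exact: smallest_sub. Qed.

Lemma zariski_closed_closure Y : zariski_closed (zariski_closure Y).
Proof.
exists [set f | homogeneous f /\ forall p, Y p -> vanishes_at f p].
  by move=> f [].
apply/seteqP; split=> p.
  move=> Yp f [fh fY]; move: p Yp; apply: zariski_closure_min => //.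
  exists [set f]; first by move=> _ ->.
  by apply/seteqP; split=> [p fp _ ->//|p]; apply.
move=> Hp Z [[S Sh ->] YS] f Sf; apply: Hp; split; first exact: Sh.
by move=> q /YS; apply.
Qed.

Lemma zariski_closureS Y Z : Y `<=` Z -> zariski_closure Y `<=` zariski_closure Z.
Proof.
move=> YZ; apply: zariski_closure_min; first exact: zariski_closed_closure.
exact: subset_trans YZ (@sub_zariski_closure _).
Qed.

Lemma vanishes_on_closure f Y :
  vanishes_on f (cone Y) -> vanishes_on f (cone (zariski_closure Y)).
Proof.
move=> fY x [p Yp]; move: x; move: p Yp.
apply: zariski_closure_min; first exact: zariski_closed_vanishing.
by move=> p Yp x xp; apply: fY; exists p.
Qed.

(** If f g vanishes on the line of a point p, then one of the two factors does, as
    univariate polynomials form a domain.  So Z is covered by two closed sets. *)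
Lemma irreducible_prime_vanishing Z : irreducible Z -> prime_vanishing (cone Z).
Proof.
move=> [_ Zirr] f g fgZ.
have [|Zf|Zg] :=
    Zirr _ _ (zariski_closed_vanishing f) (zariski_closed_vanishing g).
- move=> p Zp; suff : ray_poly f (fun i => coords p 0 i) *
      ray_poly g (fun i => coords p 0 i) == 0.
    by rewrite mulf_eq0 => /orP[] /eqP /vanishes_on_point; [left|right].
  apply/eqP/polynomial_eq0 => c c0.
  rewrite hornerM !horner_ray_poly -mevalM -meval_scale.
  by apply: fgZ; exact: cone_scale.
- by left=> x [p Zp xp]; exact: Zf xp.
- by right=> x [p Zp xp]; exact: Zg xp.
Qed.

(** * From chains to ranks *)

(** Let f_i vanish on V_i but not on V_(i+1).  A relation g between f_0, ..., f_s
    on V_(s+1) can be divided by the largest power of the last variable dividing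
    it, since the vanishing ideal is prime and f_s is not in it.  Restricted to V_s,
    where f_s = 0, the quotient becomes a nonzero relation between the earlier
    f_i. *)
Lemma chain_algindep s (V : nat -> set 'rV[C]_N.+1) (f : nat -> {mpoly C[N.+1]})
    (g : {mpoly C[s]}) :
  V 0%N !=set0 ->
  (forall i, (i < s)%N -> [/\ prime_vanishing (V i.+1),
     forall u, vanishes_on u (V i.+1) -> vanishes_on u (V i),
     vanishes_on (f i) (V i) & ~ vanishes_on (f i) (V i.+1)]) ->
  vanishes_on (subst (fun i : 'I_s => f i) g) (V s) -> g = 0.
Proof.
move=> V0; elim: s g => [|s IHs] g Vf.
  case: V0 => x Vx /(_ x Vx); rewrite [g]nvar0_mpolyC mmapC mevalC => ->.
  by rewrite mpolyC0.
have [Vp Vsub fV fV'] := Vf s (leqnn _).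
rewrite mmap_muni /=; set phi := map_poly _.
move=> gV; apply/eqP; have [//|g0] := eqVneq g 0; exfalso.
have P0 : muni g != 0 by apply: contra_neq g0; exact: muni_eq0.
have [k [Q]] := multiplicity_XsubC (muni g) 0; rewrite P0 /= => Q0 PE.
move/negP: Q0; apply; apply/rootP.
apply: IHs => [i si|]; first by apply: Vf; exact: ltnW.
pose phi_rm : {rmorphism {mpoly C[s]} -> {mpoly C[N.+1]}} :=
  subst (fun i : 'I_s => f (widen_ord (leqnSn s) i)).
move: gV; rewrite PE /phi rmorphM rmorphXn /= rmorphB /= map_polyX map_polyC /=.
rewrite mmap0 subr0 hornerM horner_exp hornerX.
move=> /(prime_vanishing_cancel Vp fV') /Vsub QV x Vx; move: (QV x Vx).
rewrite -[subst _ Q.[0]]/(phi_rm Q.[0]) -(horner_map phi_rm) raddf0.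
by rewrite -!(horner_map (meval (fun i => x 0 i))) /= (fV x Vx) meval0.
Qed.

Lemma exists_coordinate (x : 'rV[C]_N.+1) : x != 0 -> exists j, x 0 j != 0.
Proof.
move=> x0; apply/existsP; rewrite -negb_forall; apply: contra x0 => /forallP x0.
by apply/eqP/rowP => j; rewrite mxE; exact/eqP.
Qed.

Lemma coords_neq0 (p : PN) : coords p != 0.
Proof. exact: (valP (repr p)). Qed.

Lemma chain_step_equation Y Z : zariski_closed Y -> Y `<` Z ->
  exists f, vanishes_on f (cone Y) /\ ~ vanishes_on f (cone Z).
Proof.
move=> [S Sh ->] [_ /existsNP[p /not_implyP[Zp]]].
move=> /existsNP[f /not_implyP[Sf fp]]; exists f; split.
  move=> x [p' /(_ f Sf) fp' xp'].
  exact/(vanishes_at_represents (Sh _ Sf) xp').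
by move=> fZ; apply: fp; apply: fZ; exact: cone_coords.
Qed.

(** The hypothesis says that the cone over Y lies in the closure of the image of
    G. *)
Lemma chain_jacobian_rank q (G : 'I_N.+1 -> {mpoly C[q]}) Y d
    (Z : nat -> set PN) :
  (forall f, subst G f = 0 -> vanishes_on f (cone Y)) ->
  irreducible_chain Y d Z ->
  exists v, (d.+1 <= \rank (map_mx (meval v) (jacobian G)))%N.
Proof.
move=> GY [Zirr Zlt].
(* The chain of cones starts with the vertex 0, which makes room for one more
   polynomial than the length of the chain of projective sets. *)
pose V i : set 'rV[C]_N.+1 := if i is j.+1 then cone (Z j) else [set 0].
have fP i : exists f, (i <= d)%N ->
    vanishes_on f (V i) /\ ~ vanishes_on f (V i.+1).
  case: i => [|i].
    have [_ [[p Zp] _] _] := Zirr 0%N (leq0n d).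
    have [j pj] := exists_coordinate (coords_neq0 p).
    exists 'X_j => _; split=> [x /= ->|]; first by rewrite mevalXU mxE.
    move/(_ _ (cone_coords Zp)); rewrite mevalXU => /eqP.
    by rewrite (negbTE pj).
  have [id|di] := ltnP i d; last by exists 0.
  have [Zc _ _] := Zirr i (ltnW id).
  by have [f fZ] := chain_step_equation Zc (Zlt i id); exists f.
have [f fV] := choice fP.
have VP i : (i < d.+1)%N -> [/\ prime_vanishing (V i.+1),
    forall u, vanishes_on u (V i.+1) -> vanishes_on u (V i),
    vanishes_on (f i) (V i) & ~ vanishes_on (f i) (V i.+1)].
  rewrite ltnS => id; have [fi fi'] := fV i id.
  have [_ Zi _] := Zirr i id.
  split=> //; first exact: irreducible_prime_vanishing.
  case: i {fi fi'} id Zi => [_ [[p Zp] _] u uZ x -> /=|i id _ u uZ].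
    have /vanishes_on_point up : forall x, represents x p ->
        u.@[fun i => x 0 i] = 0 by move=> y yp; apply: uZ; exists p.
    rewrite -[RHS](horner0 0) -up horner_ray_poly.
    by apply: meval_eq => j; rewrite mul0r mxE.
  move=> x [p Zp xp]; apply: uZ; exists p => //.
  by have [sub _] := Zlt i id; exact: sub.
pose fG (i : 'I_d.+1) := subst G (f i).
have fGI : algindep fG.
  move=> g; rewrite -subst_subst => /GY gY.
  apply: (@chain_algindep d.+1 V f g) => //; first by exists 0.
  move=> x [p Zp xp]; apply: gY; exists p => //.
  by have [_ _ sub] := Zirr d (leqnn d); exact: sub.
have [v /eqP rv] := exists_row_free_jacobian fGI.
by exists v; rewrite -[leqLHS]rv jacobian_subst mxrankM_maxr.
Qed.

(** * From ranks to chains *)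

Definition param_vec n (F : 'I_N.+1 -> {mpoly C[n]}) (z : 'I_n -> C) :
    'rV[C]_N.+1 := \row_j (F j).@[z].

Definition torus_image n (F : 'I_N.+1 -> {mpoly C[n]}) : set PN :=
  [set p | exists2 z : 'I_n -> C,
             forall k, z k != 0 & represents (param_vec F z) p].

(** The parameter k0 is an overall scale, so that the image of F is a cone. *)
Definition scales_in n (k0 : 'I_n) (F : 'I_N.+1 -> {mpoly C[n]}) : Prop :=
  forall j z c,
    (F j).@[fun k => (if k == k0 then c else 1) * z k] = c * (F j).@[z].

Lemma meval_param_vec n (F : 'I_N.+1 -> {mpoly C[n]}) f z :
  f.@[fun i => param_vec F z 0 i] = (subst F f).@[z].
Proof. by rewrite meval_subst; apply: meval_eq => i; rewrite mxE. Qed.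

Lemma vanishes_on_torus_image n (F : 'I_N.+1 -> {mpoly C[n]}) k0 f :
  scales_in k0 F -> subst F f = 0 -> vanishes_on f (cone (torus_image F)).
Proof.
move=> Fs Ff x [p [z _ zp] /representsP[c c0 ->]].
have /representsP[c' c'0 zE] := zp.
have -> : c *: coords p =
    param_vec F (fun k => (if k == k0 then c / c' else 1) * z k).
  apply/rowP => j; rewrite [RHS]mxE Fs.
  by move/rowP/(_ j): zE; rewrite !mxE => ->; rewrite mulrA divfK.
by rewrite meval_param_vec Ff meval0.
Qed.

Lemma row_full_jacobian_neq0 n (F : 'I_N.+1 -> {mpoly C[n.+1]}) v :
  row_full (map_mx (meval v) (jacobian F)) -> exists j, F j != 0.
Proof.
case/row_fullP => W WJ; apply/existsP; rewrite -negb_forall.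
apply/negP => /forallP F0; move/matrixP/(_ ord0 ord0): WJ => /eqP.
rewrite !mxE big1 ?eqxx 1?eq_sym ?oner_eq0 // => j _.
by rewrite !mxE (eqP (F0 j)) mderiv0 meval0 mulr0.
Qed.

Lemma exists_represented (x : 'rV[C]_N.+1) :
  x != 0 -> exists p : PN, represents x p.
Proof.
move=> x0; pose y : nonzero_vec R N := exist _ x x0.
by exists (\pi_PN y)%qT; exact: (proj2 (represents_pi y _)).
Qed.

Lemma exists_torus_image n (F : 'I_N.+1 -> {mpoly C[n]}) j (d : {mpoly C[n]}) :
  F j != 0 -> d != 0 -> exists p z,
    [/\ torus_image F p, represents (param_vec F z) p & d.@[z] != 0].
Proof.
move=> Fj d0; have [|z z0] := @exists_nonvanishing _ _ (F j * d).
  by rewrite mulf_neq0.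
rewrite mevalM mulf_eq0 negb_or => /andP[Fz dz].
have [|p zp] := @exists_represented (param_vec F z).
  by apply: contra_neq Fz => /rowP/(_ j); rewrite !mxE.
by exists p, z; split=> //; exists z.
Qed.

(** If the image is contained in neither Z1 nor Z2, then equations f of Z1 and g of
    Z2 pull back to nonzero polynomials, and so does their product. *)
Lemma irreducible_torus_image n (F : 'I_N.+1 -> {mpoly C[n]}) j :
  F j != 0 -> irreducible (zariski_closure (torus_image F)).
Proof.
move=> Fj; split.
  have [p [z [Fp _ _]]] := exists_torus_image Fj (oner_neq0 _).
  by exists p; exact: sub_zariski_closure.
move=> Z1 Z2 Z1c Z2c FZ.
have eqnP Z : zariski_closed Z -> ~ zariski_closure (torus_image F) `<=` Z ->
    exists f, subst F f != 0 /\ forall p z, represents (param_vec F z) p ->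
      (subst F f).@[z] != 0 -> ~ Z p.
  move=> Zc FnZ.
  have /existsNP[p /not_implyP[[z z0 zp]]] : ~ torus_image F `<=` Z.
    by move=> FZ'; apply: FnZ; exact: zariski_closure_min.
  case: Zc => S Sh -> /existsNP[f /not_implyP[Sf fp]]; exists f; split.
    apply/eqP => f0; apply: fp; apply/(vanishes_at_represents (Sh _ Sf) zp).
    by rewrite meval_param_vec f0 meval0.
  move=> p' z' zp' fz' /(_ f Sf) /(vanishes_at_represents (Sh _ Sf) zp').
  by rewrite meval_param_vec => /eqP; rewrite (negbTE fz').
have [|/eqnP - /(_ Z1c) [f [f0 fZ1]]] :=
    pselect (zariski_closure (torus_image F) `<=` Z1).
  by left.
have [|/eqnP - /(_ Z2c) [g [g0 gZ2]]] :=
    pselect (zariski_closure (torus_image F) `<=` Z2).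
  by right.
have [p [z [Fp zp]]] := exists_torus_image Fj (mulf_neq0 f0 g0).
rewrite mevalM mulf_eq0 negb_or => /andP[fz gz]; exfalso.
by have [/(fZ1 _ _ zp fz)|/(gZ2 _ _ zp gz)] := FZ _ (sub_zariski_closure Fp).
Qed.

Lemma subst_eq0_torus_image n (F : 'I_N.+1 -> {mpoly C[n]}) j f :
  F j != 0 -> vanishes_on f (cone (torus_image F)) -> subst F f = 0.
Proof.
move=> Fj fF; apply/eqP; case: eqVneq => // f0.
have [p [z [Fp zp]]] := exists_torus_image Fj f0.
by rewrite -meval_param_vec fF ?eqxx //; exists p.
Qed.

(** A left inverse W of the Jacobian of F turns the coordinates into n + 2
    linear forms whose pullbacks by F have the identity as Jacobian, hence are
    algebraically independent.  Pulled back by F', which has one parameter less,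
    they satisfy a relation g.  As a polynomial in the coordinates, g vanishes on
    the image of F' and not on that of F. *)
Lemma torus_image_strict n (F : 'I_N.+1 -> {mpoly C[n.+2]})
    (F' : 'I_N.+1 -> {mpoly C[n.+1]}) v k0 :
  row_full (map_mx (meval v) (jacobian F)) -> scales_in k0 F' ->
  ~ zariski_closure (torus_image F) `<=` zariski_closure (torus_image F').
Proof.
move=> full F's FF'; have [j Fj] := row_full_jacobian_neq0 full.
have /row_fullP[W WJ] := full.
pose l b : {mpoly C[N.+1]} := \sum_j W b j *: 'X_j.
have [g g0 F'g] := exists_algebraic_relation (fun b => subst F' (l b)) (ltnSn _).
have lI : algindep (fun b => subst F (l b)).
  apply: (@row_free_jacobian_algindep _ _ _ _ v); rewrite jacobian_subst.
  suff -> : map_mx (meval (fun j => (F j).@[v])) (jacobian l) = W.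
    by rewrite WJ row_free_unit unitmx1.
  apply/matrixP => b i; rewrite !mxE /l (raddf_sum (mderiv i)) rmorph_sum /=.
  rewrite (bigD1 i) //= big1 => [|k ki]; rewrite mderivZ mderiv_var mevalZ.
    by rewrite eqxx meval1 mulr1 addr0.
  by rewrite (negbTE ki) meval0 mulr0.
move/eqP: g0; apply; apply: lI; rewrite -subst_subst.
apply: subst_eq0_torus_image Fj _ => x [p Fp xp].
apply: (@vanishes_on_closure _ (torus_image F')); last first.
  by exists p => //; apply: FF'; exact: sub_zariski_closure.
by apply: vanishes_on_torus_image F's _; rewrite subst_subst.
Qed.

Definition set_last1 n (F : 'I_N.+1 -> {mpoly C[n.+2]}) (j : 'I_N.+1) :
    {mpoly C[n.+1]} :=
  subst (extend_last (fun a : 'I_n.+1 => 'X_a) 1) (F j).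

Lemma meval_set_last1 n (F : 'I_N.+1 -> {mpoly C[n.+2]}) j z :
  (set_last1 F j).@[z] = (F j).@[extend_last z 1].
Proof.
rewrite meval_subst; apply: meval_eq => k; rewrite /extend_last.
by case: unliftP => [a _|_]; rewrite ?mevalXU ?meval1.
Qed.

Lemma torus_image_set_last1 n (F : 'I_N.+1 -> {mpoly C[n.+2]}) :
  torus_image (set_last1 F) `<=` torus_image F.
Proof.
move=> p [z z0 zp]; exists (extend_last z 1) => [k|].
  by rewrite /extend_last; case: unliftP => [a _|_]; rewrite ?oner_neq0.
congr represents: zp; apply/rowP => j.
by rewrite !mxE meval_set_last1.
Qed.

(** Freezing a parameter deletes its column from the Jacobian. *)
Lemma set_last1_row_full n (F : 'I_N.+1 -> {mpoly C[n.+2]}) :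
  row_full (map_mx (meval (fun=> 1)) (jacobian F)) ->
  row_full (map_mx (meval (fun=> 1)) (jacobian (set_last1 F))).
Proof.
case/row_fullP => W WJ; apply/row_fullP.
pose S : 'M[C]_(n.+2, n.+1) := \matrix_(k, a) (k == lift ord_max a)%:R.
exists (S^T *m W); rewrite /set_last1 jacobian_subst.
set J := map_mx _ (jacobian F); set J' := map_mx _ _.
have -> : J = map_mx (meval (fun=> 1)) (jacobian F).
  apply/matrixP => j k; rewrite !mxE; apply: meval_eq => l.
  by rewrite /extend_last; case: unliftP => [a _|_]; rewrite ?mevalXU ?meval1.
have -> : J' = S.
  apply/matrixP => k a; rewrite !mxE /extend_last; case: unliftP => [b ->|->].
    by rewrite mderiv_var (inj_eq lift_inj) rmorph_nat.
  by rewrite -mpolyC1 mderivC meval0 (negbTE (neq_lift _ _)).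
rewrite mulmxA -(mulmxA _ W) WJ mulmx1; apply/matrixP => a b.
rewrite !mxE (bigD1 (lift ord_max a)) //= !mxE eqxx mul1r big1 => [|k ka].
  by rewrite addr0 (inj_eq lift_inj).
by rewrite !mxE (negbTE ka) mul0r.
Qed.

Lemma set_last1_scales n (F : 'I_N.+1 -> {mpoly C[n.+2]}) :
  scales_in ord0 F -> scales_in ord0 (set_last1 F).
Proof.
move=> Fs j z c; rewrite !meval_set_last1 -Fs; apply: meval_eq => k.
rewrite /extend_last; case: unliftP => [a ->|->]; last by rewrite mulr1.
by rewrite -!val_eqE /= /bump leqNgt ltn_ord add0n.
Qed.

(** The chain for one parameter less, followed by the closure of the image of F
    itself.  The base point is (1, ..., 1), so that a parameter is frozen by giving
    it the value 1. *)
Lemma torus_image_chain n (F : 'I_N.+1 -> {mpoly C[n.+1]}) :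
  scales_in ord0 F -> row_full (map_mx (meval (fun=> 1)) (jacobian F)) ->
  exists Z : nat -> set PN,
    irreducible_chain (zariski_closure (torus_image F)) n Z.
Proof.
elim: n F => [|n IHn] F Fs full; have [j Fj] := row_full_jacobian_neq0 full.
  exists (fun=> zariski_closure (torus_image F)); split=> [i _|//].
  split=> //; first exact: zariski_closed_closure.
  exact: irreducible_torus_image Fj.
have [Z [Zirr Zlt]] := IHn _ (set_last1_scales Fs) (set_last1_row_full full).
exists (fun i => if (i <= n)%N then Z i else zariski_closure (torus_image F)).
have sub := zariski_closureS (@torus_image_set_last1 _ F).
split=> i.
  rewrite leq_eqVlt => /predU1P[->|]; rewrite ?ltnn ?ltnS.
    split=> //; first exact: zariski_closed_closure.
    exact: irreducible_torus_image Fj.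
  move=> id; rewrite id; have [Zc Zi ZY] := Zirr i id.
  by split=> //; exact: subset_trans ZY sub.
rewrite ltnS => id; rewrite id; case: ltnP => [/Zlt//|ni].
have [_ _ ZY] := Zirr i id; split; first exact: subset_trans ZY sub.
move=> FZ; have := torus_image_strict full (set_last1_scales Fs).
by apply; exact: subset_trans FZ ZY.
Qed.

(** The hypothesis on the derivative with respect to k0 ensures that the scale can
    be among the chosen parameters. *)
Lemma jacobian_rank_chain q (F : 'I_N.+1 -> {mpoly C[q]}) k0 v j0 s :
  scales_in k0 F -> (forall k, v k != 0) -> (F j0)^`M(k0).@[v] != 0 ->
  (s < \rank (map_mx (meval v) (jacobian F)))%N ->
  exists Z : nat -> set PN,
    irreducible_chain (zariski_closure (torus_image F)) s Z.
Proof.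
move=> Fs v0 Fk0 sF; set J := map_mx _ _ in sF.
pose M := (J *m diag_mx (\row_k v k))^T.
have ME k j : M k j = (F j)^`M(k).@[v] * v k.
  rewrite !mxE (bigD1 k) //= big1 => [|l lk]; rewrite !mxE.
    by rewrite eqxx mulr1n addr0.
  by rewrite (negbTE lk) mulr0n mulr0.
have [||k [kk0 kfree]] := @exists_free_rows _ _ _ M k0 s.
- apply: contra_neq Fk0 => /rowP/(_ j0); rewrite mxE ME mxE => /eqP.
  by rewrite mulf_eq0 (negbTE (v0 k0)) orbF => /eqP.
- by rewrite /M mxrank_tr rank_mul_diag // => k; rewrite mxE.
(* The parameter k a becomes v (k a) times the new variable a, and all the other
   parameters are frozen at their values in v. *)
pose sg l : {mpoly C[s.+1]} :=
  v l *: mpolyX C (Multinom [tuple (k a == l : nat) | a < s.+1]).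
have sgE l z : (sg l).@[z] = v l * \prod_a z a ^+ (k a == l).
  rewrite mevalZ mevalX; congr (_ * _).
  by apply: eq_bigr => a _; rewrite mnmE.
have sg1 : (fun l => (sg l).@[fun=> 1]) = v.
  apply/funext => l; rewrite sgE big1 ?mulr1 // => a _; exact: expr1n.
pose H j := subst sg (F j).
have Hs : scales_in ord0 H.
  move=> j z c; rewrite !meval_subst -Fs; apply: meval_eq => l.
  rewrite !sgE mulrCA; congr (_ * _); under eq_bigr do rewrite exprMn.
  rewrite big_split /=; congr (_ * _); rewrite (bigD1 ord0) //= big1 => [|a a0].
    by rewrite kk0 mulr1 eq_sym; case: eqP.
  by rewrite (negbTE a0) expr1n.
have HJ : map_mx (meval (fun=> 1)) (jacobian H) = (rowsub k M)^T.
  rewrite jacobian_subst sg1; apply/matrixP => j a.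
  rewrite [RHS]mxE [RHS]mxE ME mxE.
  rewrite (bigD1 (k a)) //= big1 => [|l lk]; rewrite !mxE mderivZ mderivX mnmE.
    rewrite eqxx scale1r mevalZ mevalX big1 ?mulr1 ?addr0 // => b _.
    exact: expr1n.
  by rewrite eq_sym (negbTE lk) scale0r scaler0 meval0 mulr0.
have HF : torus_image H `<=` torus_image F.
  move=> p [z z0 zp]; exists (fun l => (sg l).@[z]) => [l|].
    by rewrite sgE mulf_neq0 //; apply/prodf_neq0 => a _; rewrite expf_neq0.
  by congr represents: zp; apply/rowP => j; rewrite !mxE meval_subst.
have [|Z [Zirr Zlt]] := torus_image_chain Hs.
  by rewrite HJ /row_full mxrank_tr (eqP kfree).
exists Z; split=> // i /Zirr[Zc Zi ZH]; split=> //.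
exact: subset_trans ZH (zariski_closureS HF).
Qed.

End Cones.

(** * Degeneration of the product of secant varieties *)

Section Degeneration.
Variables (K : numFieldType) (N n m : nat) (A : 'M[nat]_(n.+1, N.+1)).
Variables (T : finType) (kappa : T -> 'I_m).
Implicit Types (b : option T) (t : T) (p : 'I_n.+2) (j : 'I_N.+1).

Local Notation q := #|{: option T * 'I_n.+2}|.

(** The parameters are arranged in blocks: None is the distinguished block u_0, and
    the block Some t belongs to the factor kappa t of the product.  In each block,
    ord0 is the scale and lift ord0 i is the i-th torus coordinate. *)
Definition var b p : 'I_q := enum_rank (b, p).

Definition aug_exponent (c : nat) p j : nat :=
  if unlift ord0 p is Some i then A i j else c.

Definition block_exponent c b j : multinom q :=
  Multinom [tuple (if (enum_val k).1 == b then aug_exponent c (enum_val k).2 j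
                   else 0)%N | k < q].

(** The j-th coordinate of lambda ^ c x^A, where (lambda, x) is the block b. *)
Definition block_monomial c b j : {mpoly K[q]} :=
  mpolyX K (block_exponent c b j).

Lemma block_exponentE c b j b' p :
  block_exponent c b j (var b' p) = if b' == b then aug_exponent c p j else 0%N.
Proof. by rewrite mnmE /var enum_rankK. Qed.

Lemma meval_block_monomial c b j z : (block_monomial c b j).@[z] =
  z (var b ord0) ^+ c * \prod_i z (var b (lift ord0 i)) ^+ A i j.
Proof.
rewrite mevalX (reindex (fun x : option T * 'I_n.+2 => enum_rank x)) /=; last first.
  by exists enum_val => x _; rewrite ?enum_rankK ?enum_valK.
rewrite (bigID (fun x => x.1 == b)) /= [X in _ * X]big1 ?mulr1; last first.
  by case=> b' p /= bb'; rewrite block_exponentE (negbTE bb').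
rewrite (reindex_onto (fun p => (b, p)) snd) /=; last first.
  by case=> b' p /= /eqP ->.
under eq_bigl do rewrite !eqxx.
under eq_bigr do rewrite block_exponentE eqxx.
rewrite big_ord_recl /aug_exponent unlift_none; congr (_ * _).
by apply: eq_bigr => i _; rewrite liftK.
Qed.

Lemma block_monomial1E b j :
  block_monomial 1 b j = 'X_(var b ord0) * block_monomial 0 b j.
Proof.
rewrite /block_monomial -mpolyXD; congr mpolyX; apply/mnmP => k.
rewrite mnmDE mnm1E !mnmE; have [|] := eqVneq (var b ord0) k.
  by move=> <-; rewrite /var enum_rankK /= eqxx /aug_exponent unlift_none.
rewrite -(enum_valK k) /var (inj_eq enum_rank_inj); case: (enum_val k) => b' p bp.
rewrite enum_rankK add0n /=; case: eqP => [bb'|//]; move: bp.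
rewrite bb' /aug_exponent => pk.
by case: unliftP => // E; rewrite E eqxx in pk.
Qed.

(** Monomials are eigenvectors of the derivation X_k d/dX_k, which makes the
    Jacobians below explicit; on the torus they have the same rank as the usual
    ones. *)
Definition log_derivative k (f : {mpoly K[q]}) : {mpoly K[q]} := 'X_k * f^`M(k).

Lemma log_derivativeM k f g : log_derivative k (f * g) =
  log_derivative k f * g + f * log_derivative k g.
Proof.
rewrite /log_derivative mderivM mulrDr; congr (_ + _); first exact: mulrA.
exact: mulrCA.
Qed.

Lemma log_derivative_sum I (s : seq I) (P : pred I) (F : I -> {mpoly K[q]}) k :
  log_derivative k (\sum_(i <- s | P i) F i) =
  \sum_(i <- s | P i) log_derivative k (F i).
Proof. by rewrite /log_derivative raddf_sum mulr_sumr. Qed.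

Lemma log_derivative1D k f : log_derivative k (1 + f) = log_derivative k f.
Proof. by rewrite /log_derivative mderivD -mpolyC1 mderivC add0r. Qed.

Lemma log_derivative_block b p b' j :
  log_derivative (var b p) (block_monomial 1 b' j) =
  if b == b' then (aug_exponent 1 p j)%:R *: block_monomial 1 b' j else 0.
Proof.
rewrite /log_derivative mderivX -scalerAr block_exponentE.
case: eqP => [->|_]; last by rewrite scale0r.
have [->|e0] := eqVneq (aug_exponent 1 p j) 0%N; first by rewrite !scale0r.
rewrite -mpolyXD; congr (_ *: mpolyX _ _); rewrite addmC submK //.
by rewrite lep1mP block_exponentE eqxx.
Qed.

Definition secant_map j : {mpoly K[q]} := \sum_b block_monomial 1 b j.

Definition affine_factor (k : 'I_m) j : {mpoly K[q]} :=
  1 + \sum_(t | kappa t == k) block_monomial 1 (Some t) j.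

Definition product_map j : {mpoly K[q]} :=
  block_monomial 1 None j * \prod_k affine_factor k j.

Lemma log_derivative_secant_map b p j : log_derivative (var b p) (secant_map j) =
  (aug_exponent 1 p j)%:R *: block_monomial 1 b j.
Proof.
rewrite /secant_map log_derivative_sum (bigD1 b) //= big1 => [|b' bb'].
  by rewrite log_derivative_block eqxx addr0.
by rewrite log_derivative_block eq_sym (negbTE bb').
Qed.

Lemma log_derivative_affine_factor b p k j :
  log_derivative (var b p) (affine_factor k j) =
  if b is Some t then if kappa t == k
    then (aug_exponent 1 p j)%:R *: block_monomial 1 b j else 0 else 0.
Proof.
rewrite /affine_factor log_derivative1D log_derivative_sum.
under eq_bigr do rewrite log_derivative_block.
case: b => [t|]; last by rewrite big1.
case: ifP => [tk|tk].
  rewrite (bigD1 t) //= eqxx big1 ?addr0 // => t' /andP[_ tt'].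
  by case: eqP => // -[tE]; rewrite tE eqxx in tt'.
by apply: big1 => t' t'k; case: eqP => // -[tE]; rewrite tE t'k in tk.
Qed.

(** The logarithmic derivative of the product map in a direction of the block b,
    divided by the scale of that block if b is not the distinguished block. *)
Definition reduced_derivative b p j : {mpoly K[q]} := (aug_exponent 1 p j)%:R *:
  if b is Some t then block_monomial 1 None j * (block_monomial 0 b j *
    \prod_(k | k != kappa t) affine_factor k j)
  else product_map j.

Definition block_weight b : {mpoly K[q]} :=
  if b is Some _ then 'X_(var b ord0) else 1.

Lemma log_derivative_prod0 I (s : seq I) (P : pred I) (F : I -> {mpoly K[q]}) k :
  (forall i, P i -> log_derivative k (F i) = 0) ->
  log_derivative k (\prod_(i <- s | P i) F i) = 0.
Proof.
move=> F0; apply: (big_ind (fun f => log_derivative k f = 0)) => //.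
  by rewrite /log_derivative -mpolyC1 mderivC mulr0.
by move=> f g f0 g0; rewrite log_derivativeM f0 g0 mul0r mulr0 addr0.
Qed.

Lemma log_derivative_product_map b p j :
  log_derivative (var b p) (product_map j) =
  block_weight b * reduced_derivative b p j.
Proof.
rewrite /product_map log_derivativeM log_derivative_block; case: b => [t|] /=.
  rewrite mul0r add0r (bigD1 (kappa t)) //= log_derivativeM.
  rewrite log_derivative_affine_factor eqxx.
  rewrite log_derivative_prod0 ?mulr0 ?addr0 => [|k kt]; last first.
    by rewrite log_derivative_affine_factor eq_sym (negbTE kt).
  rewrite (block_monomial1E (Some t)) /reduced_derivative -!scalerAl -!scalerAr.
  by congr (_ *: _); rewrite -!mulrA mulrCA.
rewrite log_derivative_prod0 ?mulr0 ?addr0 ?mul1r => [|k _].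
  by rewrite -scalerAl.
by rewrite log_derivative_affine_factor.
Qed.

Lemma jacobian_log_derivative (F : 'I_N.+1 -> {mpoly K[q]}) v :
  map_mx (meval v) (jacobian F) *m diag_mx (\row_k v k) =
  \matrix_(j, k) (log_derivative k (F j)).@[v].
Proof.
apply/matrixP => j k; rewrite !mxE (bigD1 k) //= big1 => [|l lk]; rewrite !mxE.
  by rewrite eqxx mulr1n addr0 /log_derivative mevalM mevalXU mulrC.
by rewrite (negbTE lk) mulr0n mulr0.
Qed.

Definition reduced_jacobian : 'M[{mpoly K[q]}]_(N.+1, q) :=
  \matrix_(j, k) reduced_derivative (enum_val k).1 (enum_val k).2 j.

Lemma rank_product_map_reduced v : (forall k, v k != 0) ->
  \rank (map_mx (meval v) (jacobian product_map)) =
  \rank (map_mx (meval v) reduced_jacobian).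
Proof.
move=> v0.
rewrite -(rank_mul_diag (D := \row_k v k)) => [|k]; last by rewrite mxE.
rewrite jacobian_log_derivative.
rewrite -[RHS](rank_mul_diag (D := \row_k (block_weight (enum_val k).1).@[v])).
  congr mxrank; apply/matrixP => j k; rewrite !mxE (bigD1 k) //= big1 => [|l lk].
    rewrite !mxE eqxx mulr1n addr0 mulrC -mevalM -log_derivative_product_map.
    by rewrite /var -surjective_pairing enum_valK.
  by rewrite !mxE (negbTE lk) mulr0n mulr0.
move=> k; rewrite mxE; case: (enum_val k).1 => [t|] /=; first by rewrite mevalXU.
by rewrite meval1 oner_neq0.
Qed.

Section Limit.
Variable v : 'I_q -> K.

(** The scales of the ordinary blocks are 0 and the distinguished block is the unit
    of the torus.  The torus coordinates of the others are divided by those of the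
    distinguished block, which compensates for having moved it to the unit. *)
Definition limit_point (k : 'I_q) : K :=
  if (enum_val k).1 is Some _ then
    if (enum_val k).2 == ord0 then 0 else v k / v (var None (enum_val k).2)
  else 1.

Lemma limit_block_None c j : (block_monomial c None j).@[limit_point] = 1.
Proof.
rewrite meval_block_monomial /limit_point /var enum_rankK expr1n mul1r.
by rewrite big1 // => i _; rewrite enum_rankK expr1n.
Qed.

Lemma limit_block_Some t j : (block_monomial 1 (Some t) j).@[limit_point] = 0.
Proof. by rewrite meval_block_monomial /limit_point /var enum_rankK mul0r. Qed.

Lemma limit_block_ratio t j : (block_monomial 0 (Some t) j).@[limit_point] =
  (block_monomial 0 (Some t) j).@[v] / (block_monomial 0 None j).@[v].
Proof.
rewrite !meval_block_monomial !expr0 !mul1r -prodf_div; apply: eq_bigr => i _.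
by rewrite /limit_point /var enum_rankK /= expr_div_n.
Qed.

Lemma limit_affine_factor k j : (affine_factor k j).@[limit_point] = 1.
Proof.
rewrite /affine_factor mevalD meval1 rmorph_sum big1 ?addr0 // => t _.
exact: limit_block_Some.
Qed.

Lemma limit_product_map j : (product_map j).@[limit_point] = 1.
Proof.
rewrite /product_map mevalM limit_block_None mul1r rmorph_prod big1 // => k _.
exact: limit_affine_factor.
Qed.

End Limit.

(** At the limit point all the factors of the product equal 1, so the reduced
    logarithmic derivatives are products of an exponent with x_t^A / x_0^A.  Those
    of the secant map are products of the same exponent with lambda_t x_t^A, so the
    two matrices differ by diagonal factors. *)
Lemma rank_secant_map_limit v : (forall k, v k != 0) ->
  (\rank (map_mx (meval v) (jacobian secant_map)) <=
   \rank (map_mx (meval (limit_point v)) reduced_jacobian))%N.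
Proof.
move=> v0.
rewrite -(rank_mul_diag (D := \row_k v k)) => [|k]; last by rewrite mxE.
rewrite jacobian_log_derivative; set M := map_mx _ reduced_jacobian.
pose D1 := \row_j (block_monomial 0 None j).@[v].
pose D2 : 'rV[K]_q := \row_k v (var (enum_val k).1 ord0).
suff -> : \matrix_(j, k) (log_derivative k (secant_map j)).@[v] =
    diag_mx D1 *m (M *m diag_mx D2).
  exact: leq_trans (mxrankM_maxr _ _) (mxrankM_maxl _ _).
have D1_0 j : (block_monomial 0 None j).@[v] != 0.
  rewrite meval_block_monomial expr0 mul1r; apply/prodf_neq0 => i _.
  by rewrite expf_neq0.
apply/matrixP => j k; rewrite !mul_diag_mx !mul_mx_diag !mxE.
have -> : k = var (enum_val k).1 (enum_val k).2.
  by rewrite /var -surjective_pairing enum_valK.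
rewrite log_derivative_secant_map /var enum_rankK /= /reduced_derivative.
rewrite block_monomial1E !mevalZ mevalM mevalXU; case: (enum_val k).1 => [t|].
  rewrite !mevalM limit_block_None mul1r limit_block_ratio rmorph_prod big1 /=.
    by rewrite mulr1; field; exact: D1_0.
  by move=> k' _; exact: limit_affine_factor.
by rewrite limit_product_map mulr1; ring.
Qed.

Lemma rank_secant_map_le v : exists v', [/\ forall k, v' k != 0,
  (product_map ord0)^`M(var None ord0).@[v'] != 0 &
  (\rank (map_mx (meval v) (jacobian secant_map)) <=
   \rank (map_mx (meval v') (jacobian product_map)))%N].
Proof.
have [v1 [v10 _ rv1]] :=
  rank_meval_generic (jacobian secant_map) v (oner_neq0 _).
have [|v' [v'0 Fv' rv']] := @rank_meval_generic _ _ _ _ reduced_jacobian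
    (limit_point v1) (product_map ord0).
  apply/eqP => /(congr1 (meval (limit_point v1))).
  by rewrite limit_product_map // meval0 => /eqP; rewrite oner_eq0.
exists v'; split=> //.
  have := log_derivative_product_map None ord0 ord0.
  rewrite /log_derivative /= /reduced_derivative /aug_exponent unlift_none.
  rewrite mul1r scale1r => /(congr1 (meval v')); rewrite mevalM => E.
  by apply: contra_neq Fv' => F0; rewrite -E F0 mulr0.
rewrite (rank_product_map_reduced v'0) (leq_trans rv1) // (leq_trans _ rv') //.
exact: rank_secant_map_limit.
Qed.

End Degeneration.

(** * Parametrization of secant varieties and of their products *)

Section Varieties.
Variables (R : realType) (N : nat).
Local Notation C := (R[i]).
Local Notation PN := (PN R N).
Implicit Types (X Y Z : set PN) (x y : 'rV[C]_N.+1).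
Local Open Scope classical_set_scope.

Lemma cone_hadamard Y Z x y : cone Y x -> cone Z y -> hadamard_vec x y != 0 ->
  cone (hadamard Y Z) (hadamard_vec x y).
Proof.
move=> [p Yp /representsP[c c0 xE]] [q Zq /representsP[d d0 yE]] xy0.
have [s xys] := exists_represented xy0; exists s => //.
apply: sub_zariski_closure; exists p, q; split=> //.
have /representsP[e e0 sE] := xys.
apply/representsP; exists (e / (c * d)).
  by rewrite mulf_neq0 ?invr_neq0 ?mulf_neq0.
apply/rowP => j; move/rowP/(_ j): sE; rewrite xE yE !mxE => sE.
apply: (mulfI (mulf_neq0 c0 d0)); rewrite mulrACA sE.
by field; rewrite c0 d0.
Qed.

Lemma foldl_hadamard_vecE I (s : seq I) (w : I -> 'rV[C]_N.+1) x j :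
  (foldl (@hadamard_vec R N) x [seq w i | i <- s]) 0 j =
  x 0 j * \prod_(i <- s) w i 0 j.
Proof.
elim: s x => [|i s IHs] x /=; first by rewrite big_nil mulr1.
by rewrite IHs big_cons mxE mulrA.
Qed.

Lemma cone_foldl_hadamard I (s : seq I) (W : I -> set PN)
    (w : I -> 'rV[C]_N.+1) Y x :
  cone Y x -> (forall i, w i != 0 -> cone (W i) (w i)) ->
  foldl (@hadamard_vec R N) x [seq w i | i <- s] != 0 ->
  cone (foldl (@hadamard R N) Y [seq W i | i <- s])
    (foldl (@hadamard_vec R N) x [seq w i | i <- s]).
Proof.
move=> + Ww; elim: s Y x => [//|i s IHs] Y x Yx /= xs0.
have xi0 : hadamard_vec x (w i) != 0.
  apply: contra_neq xs0 => xi0; apply/rowP => j.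
  by rewrite foldl_hadamard_vecE xi0 !mxE mul0r.
apply: IHs => //; apply: cone_hadamard => //; apply: Ww.
by apply: contra_neq xi0 => wi0; apply/rowP => j; rewrite !mxE wi0 mxE mulr0.
Qed.

Lemma zariski_closed_foldl_hadamard (Ys : seq (set PN)) Y :
  zariski_closed Y -> zariski_closed (foldl (@hadamard R N) Y Ys).
Proof.
elim: Ys Y => [//|Z Ys IHYs] Y _ /=.
by apply: IHYs; exact: zariski_closed_closure.
Qed.

Lemma cone_secant r X (y : 'I_r -> 'rV[C]_N.+1) :
  (forall i, cone X (y i)) -> \sum_i y i != 0 -> cone (secant r X) (\sum_i y i).
Proof.
move=> Xy y0; have [p yp] := exists_represented y0; exists p => //.
apply: sub_zariski_closure.
have /choice[q qP] : forall i, exists q, X q /\ represents (y i) q.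
  by move=> i; have [q Xq yq] := Xy i; exists q.
exists q => [i|]; first by have [] := qP i.
rewrite /in_span; have /andP[_ py] := yp; apply: submx_trans py _.
apply: summx_sub => i _; have [_ /andP[yq _]] := qP i.
apply: submx_trans yq _.
by rewrite -[coords (q i)](rowK (fun i => coords (q i))) row_sub.
Qed.

Section MonomialParametrization.
Variables (n m : nat) (A : 'M[nat]_(n.+1, N.+1)) (T : finType) (kappa : T -> 'I_m).
Local Notation q := #|{: option T * 'I_n.+2}|.
Local Notation X0 := (monomial_image (R := R) A).

Lemma cone_monomial (t : 'I_n.+1 -> C) c : (forall i, t i != 0) -> c != 0 ->
  cone X0 (c *: monomial_vec A t).
Proof.
move=> t0 c0; have [|p tp] := @exists_represented R N (monomial_vec A t).
  apply/eqP => /rowP/(_ ord0); rewrite !mxE => /eqP; apply/negP.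
  by apply/prodf_neq0 => i _; rewrite expf_neq0.
exists p; first by exists t.
have /representsP[d d0 ->] := tp; rewrite scalerA.
by apply/representsP; exists (c * d) => //; rewrite mulf_neq0.
Qed.

Lemma block_vecE b (z : 'I_q -> C) :
  \row_j (block_monomial C A 1 b j).@[z] =
  z (var b ord0) *: monomial_vec A (fun i => z (var b (lift ord0 i))).
Proof. by apply/rowP => j; rewrite !mxE meval_block_monomial expr1. Qed.

Lemma hadamard_monomial (t u : 'I_n.+1 -> C) c d :
  hadamard_vec (c *: monomial_vec A t) (d *: monomial_vec A u) =
  (c * d) *: monomial_vec A (fun i => t i * u i).
Proof.
apply/rowP => j; rewrite !mxE mulrACA -big_split; congr (_ * _).
by apply: eq_bigr => i _; rewrite exprMn.
Qed.

(** Translates of points of X by torus elements are points of X, so such a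
    translate of 1 + sum_t v(u_t) is a sum of one more points of the cone over X
    than there are blocks in the factor k. *)
Lemma cone_affine_factor k (z : 'I_q -> C) (t : 'I_n.+1 -> C) c :
  let y := hadamard_vec (c *: monomial_vec A t)
             (\row_j (affine_factor C A kappa k j).@[z]) in
  (forall k, z k != 0) -> (forall i, t i != 0) -> c != 0 -> y != 0 ->
  cone (secant #|[pred s | kappa s == k]|.+1 (zariski_closure X0)) y.
Proof.
move=> y z0 t0 c0.
pose w i : 'rV[C]_N.+1 :=
  if unlift ord0 i is Some i' then
    hadamard_vec (c *: monomial_vec A t) (\row_j (block_monomial C A 1
       (Some (enum_val (A := [pred s | kappa s == k]) i')) j).@[z])
  else c *: monomial_vec A t.
have -> : y = \sum_i w i.
  apply/rowP => j; rewrite big_ord_recl [RHS]mxE summxE /w unlift_none /y !mxE.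
  rewrite /affine_factor mevalD meval1 mulrDr mulr1; congr (_ + _).
  rewrite rmorph_sum mulr_sumr /= (eq_bigl (mem [pred s | kappa s == k])) //.
  rewrite big_enum_val.
  by apply: eq_bigr => i _; rewrite liftK !mxE.
apply: cone_secant => i; rewrite /w; case: unliftP => [i' _|_].
  rewrite block_vecE hadamard_monomial.
  have [p X0p pE] := @cone_monomial
    (fun i => t i * z (var (Some (enum_val i')) (lift ord0 i)))
    (c * z (var (Some (enum_val i')) ord0))
    (fun i => mulf_neq0 (t0 i) (z0 _)) (mulf_neq0 c0 (z0 _)).
  by exists p => //; exact: sub_zariski_closure.
have [p X0p pE] := cone_monomial t0 c0.
by exists p => //; exact: sub_zariski_closure.
Qed.

(** Composing f with an affine map gives an inhomogeneous polynomial even when f is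
    homogeneous; this is why vanishing on closures is established for arbitrary
    polynomials. *)
Lemma vanishes_on_affine_substitution (f : {mpoly C[N.+1]})
    (g : 'rV[C]_N.+1 -> 'rV[C]_N.+1) (w : 'rV[C]_N.+1) (c : C) Y :
  (forall v, g v = c *: v + w) ->
  (forall v, cone Y v -> f.@[fun i => g v 0 i] = 0) ->
  forall v, cone (zariski_closure Y) v -> f.@[fun i => g v 0 i] = 0.
Proof.
move=> gE fY.
pose h := subst (fun j => c *: 'X_j + (w 0 j)%:MP) f : {mpoly C[N.+1]}.
have hE (v : 'rV[C]_N.+1) : h.@[fun i => v 0 i] = f.@[fun i => g v 0 i].
  rewrite meval_subst; apply: meval_eq => j.
  by rewrite mevalD mevalZ mevalXU mevalC gE !mxE.
move=> v Yv; rewrite -hE; apply: (vanishes_on_closure _ Yv) => u Yu.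
by rewrite hE; exact: fY.
Qed.

(** The points spanning the secant space are moved from the image of the monomial
    map to its closure one at a time, with the others fixed; s lists those that have
    been moved. *)
Lemma secant_map_vanishes f (s : seq (option T)) (y : option T -> 'rV[C]_N.+1) c :
  subst (secant_map C A T) f = 0 ->
  (forall b,
     if b \in s then cone (zariski_closure X0) (y b) else cone X0 (y b)) ->
  f.@[fun i => (\sum_b c b *: y b) 0 i] = 0.
Proof.
move=> f0; elim: s y => [|b0 s IHs] y ys.
  have /choice[p pP] : forall b, exists p : ('I_n.+1 -> C) * C,
      y b = p.2 *: monomial_vec A p.1.
    move=> b; have [p [t t0 /representsP[d d0 tp]] /representsP[e e0 yE]] := ys b.
    exists (t, e / d); rewrite yE /= tp scalerA divfK //.
  pose z (k : 'I_q) : C := let: (b, i) := enum_val k in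
    if unlift ord0 i is Some i' then (p b).1 i' else c b * (p b).2.
  transitivity ((subst (secant_map C A T) f).@[z]); last by rewrite f0 meval0.
  rewrite meval_subst; apply: meval_eq => j; rewrite summxE rmorph_sum.
  apply: eq_bigr => b _ /=; rewrite meval_block_monomial pP !mxE expr1 /z.
  rewrite /var enum_rankK unlift_none -mulrA; congr (_ * (_ * _)).
  by apply: eq_bigr => i _; rewrite enum_rankK liftK.
pose yv v b := if b == b0 then v else y b.
have <- : \sum_b c b *: yv (y b0) b = \sum_b c b *: y b.
  by apply: eq_bigr => b _; rewrite /yv; case: eqP => // ->.
pose w := \sum_(b | b != b0) c b *: y b.
have gE v : \sum_b c b *: yv v b = c b0 *: v + w.
  rewrite (bigD1 b0) //= /yv eqxx; congr (_ + _).
  by apply: eq_bigr => b /negbTE ->.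
apply: (vanishes_on_affine_substitution gE) (_ : cone (zariski_closure X0) (y b0)).
  move=> v X0v; apply: IHs => b; rewrite /yv; have := ys b; rewrite inE.
  have [->|//] := eqVneq b b0; case: ifP => // _ _.
  by have [p X0p pv] := X0v; exists p => //; exact: sub_zariski_closure.
by have := ys b0; rewrite inE eqxx.
Qed.

Lemma secant_map_equations f :
  subst (secant_map C A T) f = 0 ->
  vanishes_on f (cone (secant #|{: option T}| (zariski_closure X0))).
Proof.
move=> f0; apply: vanishes_on_closure => x [p [u Xu pu] xp].
have /submxP[D xE] : (x <= \matrix_(i < #|{: option T}|) coords (u i))%MS.
  by have /andP[xs _] := xp; exact: submx_trans xs pu.
have -> : x = \sum_b D 0 (enum_rank b) *: coords (u (enum_rank b)).
  rewrite xE mulmx_sum_row (reindex (@enum_rank (option T))) /=.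
    by apply: eq_bigr => b _; rewrite rowK.
  by exists enum_val => b _; rewrite ?enum_rankK ?enum_valK.
apply: (@secant_map_vanishes _ (enum {: option T})) => // b.
by rewrite mem_enum; exact: cone_coords.
Qed.

End MonomialParametrization.

Lemma cone_represents Y x p : cone Y x -> represents x p -> Y p.
Proof.
move=> [p' Yp' xp'] xp; have x0 : x != 0.
  have /representsP[c c0 ->] := xp; rewrite scaler_eq0 negb_or c0.
  exact: coords_neq0.
pose u : nonzero_vec R N := exist _ x x0.
by rewrite (proj1 (represents_pi u p) xp) -(proj1 (represents_pi u p') xp').
Qed.

Lemma scales_in_product_map n m (A : 'M[nat]_(n.+1, N.+1)) (T : finType)
    (kappa : T -> 'I_m) :
  scales_in (var (None : option T) (ord0 : 'I_n.+2)) (product_map C A kappa).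
Proof.
move=> j z c; have blockE b :
    (block_monomial C A 1 b j).@[fun k =>
      (if k == var None ord0 then c else 1) * z k] =
    (if b is None then c else 1) * (block_monomial C A 1 b j).@[z].
  rewrite !meval_block_monomial !expr1 [RHS]mulrA; congr (_ * _).
    rewrite /var (inj_eq enum_rank_inj) xpair_eqE eqxx andbT.
    by case: b => [t|] //=.
  apply: eq_bigr => i _; rewrite /var (inj_eq enum_rank_inj) xpair_eqE.
  by rewrite [lift _ _ == _]eq_sym (negbTE (neq_lift _ _)) andbF mul1r.
rewrite /product_map !mevalM blockE -mulrA; congr (_ * (_ * _)).
rewrite !rmorph_prod; apply: eq_bigr => k _ /=.
rewrite /affine_factor !mevalD !meval1 !rmorph_sum; congr (_ + _).
by apply: eq_bigr => t _ /=; rewrite blockE mul1r.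
Qed.

(** The distinguished block is absorbed into the first factor; the other factors are
    translates by the unit of the torus. *)
Lemma torus_image_product_map n m (A : 'M[nat]_(n.+1, N.+1)) (T : finType)
    (kappa : T -> 'I_m.+1) (r : 'I_m.+1 -> nat) :
  (forall k, r k = #|[pred s | kappa s == k]|.+1) ->
  torus_image (product_map C A kappa) `<=`
  hadamard_prod [seq secant (r k) (zariski_closure (monomial_image (R := R) A))
                | k <- enum 'I_m.+1].
Proof.
move=> rE p [z z0 zp]; apply: (cone_represents _ zp).
pose w k : 'rV[C]_N.+1 := \row_j (affine_factor C A kappa k j).@[z].
pose x := \row_j (block_monomial C A 1 (None : option T) j).@[z] : 'rV[C]_N.+1.
have FE : param_vec (product_map C A kappa) z = foldl (@hadamard_vec R N)
    (hadamard_vec x (w ord0)) [seq w k | k <- map (lift ord0) (enum 'I_m)].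
  apply/rowP => j; rewrite foldl_hadamard_vecE !mxE big_map big_enum /=.
  rewrite /product_map mevalM rmorph_prod big_ord_recl mulrA; congr (_ * _).
  by apply: eq_bigr => i _; rewrite mxE.
have Fz0 : param_vec (product_map C A kappa) z != 0.
  have /representsP[c c0 ->] := zp.
  by rewrite scaler_eq0 negb_or c0 coords_neq0.
rewrite enum_ordSl /= FE; apply: cone_foldl_hadamard; last by rewrite -FE.
- rewrite /x block_vecE rE; apply: cone_affine_factor => //.
  rewrite -block_vecE; apply: contra_neq Fz0 => xw0; rewrite FE.
  apply/rowP => j.
  by rewrite foldl_hadamard_vecE [hadamard_vec _ _]xw0 !mxE mul0r.
- move=> k wk0; rewrite rE.
  have wE : w k = hadamard_vec (1 *: monomial_vec A (fun=> 1)) (w k).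
    apply/rowP => j; rewrite !mxE mul1r big1 ?mul1r // => i _; exact: expr1n.
  rewrite wE; apply: cone_affine_factor => //; rewrite -?wE //.
Qed.

End Varieties.

Theorem theorem4p3 (R : realType) (N : nat) (X : set (PN R N))
    (m : nat) (r : m.-tuple nat) :
  nondegenerate_toric X ->
  (0 < m)%N ->
  (forall k : 'I_m, (1 <= tnth r k)%N) ->
  (krull_dim (secant (\sum_(k < m) (tnth r k - 1) + 1)%N X)
     <= krull_dim (hadamard_prod [seq secant rk X | rk <- r]))%E.
Proof.
move=> [n [A [_ _ -> _]]]; case: m r => [//|m] r _ r1.
pose T : finType := {k : 'I_m.+1 & 'I_(tnth r k - 1)}.
pose kappa (s : T) : 'I_m.+1 := tag s.
have fibreE k : tnth r k = #|[pred s | kappa s == k]|.+1.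
  by rewrite /kappa card_tag_fibre card_ord subn1 prednK.
have blocksE : (\sum_(k < m.+1) (tnth r k - 1) + 1)%N = #|{: option T}|.
  rewrite card_option card_tagged addn1 sumnE big_map big_enum /=; congr _.+1.
  by apply: eq_bigr => k _; rewrite card_ord.
have rmap X' : [seq secant rk X' | rk <- r] =
    [seq secant (tnth r k) X' | k <- enum 'I_m.+1].
  by rewrite -{1}(map_tnth_enum r) -map_comp.
rewrite blocksE rmap; apply: ge_ereal_sup => _ [d [Z Zchain] <-].
have [v] := chain_jacobian_rank (@secant_map_equations R N n A T) Zchain.
have [v' [v'0 Fv' rv]] := rank_secant_map_le A kappa v.
move=> /leq_trans /(_ rv) dv'.
have [Z' [Zirr Zlt]] :=
  jacobian_rank_chain (scales_in_product_map A kappa) v'0 Fv' dv'.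
apply: ereal_sup_ubound; exists d => //; exists Z'; split=> // i /Zirr[Zc Zi ZF].
split=> //; apply: (subset_trans ZF); apply: zariski_closure_min.
  rewrite enum_ordSl; apply: zariski_closed_foldl_hadamard.
  exact: zariski_closed_closure.
exact: torus_image_product_map.
Qed.
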